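(* Let $F(x),G(x)\in\mathcal O[x]$ be monic separable polynomials of degree $n$ such that $F\equiv G \pmod{\mathfrak m^\nu}$ for some positive integer $\nu$. (1) If $F$ is irreducible in $\mathcal O[x]$ and $\nu>\delta_0(F)$, then $G$ is irreducible in $\mathcal O[x]$ and $G\approx F$. (2) If $G$ is irreducible in $\mathcal O[x]$ and $\nu>2\delta(F)/n$, where $\delta(F)=v(\operatorname{Disc}(F))$, then $F$ is irreducible in $\mathcal O[x]$ and $F\approx G$.
   Context: $k$ is a field that is complete and locally compact with respect to a discrete valuation $v$, with valuation ring $\mathcal O$ and maximal ideal $\mathfrak m$; $v$ also denotes its extension to an algebraic closure $\bar k$, normalized by $v(k^* )=\mathbb Z$. Congruences of polynomials are coefficientwise. Let $F\in\mathcal O[x]$ be monic, irreducible and separable of degree $n$, with root $\theta\in\bar k$. Put $m_0=1$, $\phi_0=1$. An Okutsu frame of $F$ is a (possibly empty) list $[\phi_1,\dots,\phi_r]$ of monic separable polynomials in $\mathcal O[x]$ of degrees $1\le m_1<\cdots<m_r<m_{r+1}:=n$ such that $v(\phi_i(\theta))/m_i<v(\phi_{i+1}(\theta))/m_{i+1}$ for $0\le i<r$, and, for $0\le i\le r$ and every monic $g\in\mathcal O[x]$ with $m_i\le\deg g<m_{i+1}$, one has $v(g(\theta))/\deg g\le v(\phi_i(\theta))/m_i$. Okutsu frames exist, and $r$ (the Okutsu depth of $F$), the degrees $m_i$ and the values $v(\phi_i(\theta))$, $1\le i\le r$, depend only on $F$. The exponent of the Okutsu discriminant of $F$ is $\delta_0(F)=\frac{n}{m_r}v(\phi_r(\theta))$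 (so $\delta_0(F)=0$ if $r=0$). A monic polynomial $G\in\mathcal O[x]$ of degree $n$ is Okutsu equivalent to $F$ (an Okutsu approximation to $F$), written $F\approx G$, if $v(G(\theta))>\frac{n}{m_r}v(\phi_r(\theta))$. The relation $\approx$ is an equivalence relation on the set of monic irreducible separable polynomials in $\mathcal O[x]$. *)

(* Defs.v *)
From HB Require Import structures.
From mathcomp Require Import all_boot all_order all_algebra all_field.
From mathcomp Require Import all_classical constructive_ereal topology.

Set Implicit Arguments.
Unset Strict Implicit.
Unset Printing Implicit Defensive.

Import Order.TTheory GRing.Theory Num.Theory.

Local Open Scope classical_set_scope.
Local Open Scope ring_scope.

(* Additive valuations of rank one with values in the rationals; this is enough
   for a discrete valuation and for its extensions to algebraic extensions. *)
Record valuation (K : fieldType) := Valuation {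
  val_fun :> K -> \bar rat;
  val_zero : val_fun 0 = +oo%E;
  val_fin : forall x, x != 0 -> val_fun x \is a fin_num;
  val_mul : forall x y, val_fun (x * y) = (val_fun x + val_fun y)%E;
  val_add : forall x y,
    (Order.min (val_fun x) (val_fun y) <= val_fun (x + y))%E }.

Section ValuationTopology.
Variables (K : fieldType) (v : valuation K).

Lemma val_one : v 1 = 0%E.
Proof.
have := val_fin v (oner_neq0 K); have := val_mul v 1 1; rewrite mulr1.
case: (v 1) => // r /eqP; rewrite -EFinD eqe => /eqP rE _.
by congr EFin; apply: (addrI r); rewrite addr0 -rE.
Qed.

Lemma val_opp x : v (- x) = v x.
Proof.
have vN1 : v (-1) = 0%E.
  have : v (-1) \is a fin_num by apply: val_fin; rewrite oppr_eq0 oner_neq0.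
  have := val_mul v (-1) (-1); rewrite mulrNN mulr1 val_one.
  case: (v (-1)) => // r /eqP; rewrite -EFinD eqe eq_sym.
  by rewrite -mulr2n mulrn_eq0 /= => /eqP ->.
by rewrite -mulN1r val_mul vN1 add0e.
Qed.

(* A copy of [K] that carries the uniform structure (hence the topology)
   defined by [v]. *)
Definition valued_field of valuation K : Type := K.

Definition val_entourage : set_system (K * K) :=
  [set A | exists q : rat, [set xy | (q%:E < v (xy.1 - xy.2)%R)%E] `<=` A].

Lemma val_entourage_filter : Filter val_entourage.
Proof.
split.
- by exists 0.
- move=> A B [p pA] [q qB]; exists (Num.max p q) => xy /= h.
  split; [apply: pA | apply: qB]; apply: le_lt_trans h;
    by rewrite lee_fin le_max lexx ?orbT.
- by move=> A B AB [q qA]; exists q; apply: subset_trans AB.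
Qed.

Lemma val_entourage_diagonal A : val_entourage A -> diagonal `<=` A.
Proof.
by move=> [q qA] [x y] /diagonalP ->; apply: qA; rewrite /= subrr val_zero ltry.
Qed.

Lemma val_entourage_inv A : val_entourage A -> val_entourage A^-1%relation.
Proof.
by move=> [q qA]; exists q => -[x y] /= h; apply: qA; rewrite /= -opprB val_opp.
Qed.

Lemma val_entourage_split A : val_entourage A ->
  exists2 B, val_entourage B & (B \; B)%relation `<=` A.
Proof.
move=> [q qA]; exists [set xy | (q%:E < v (xy.1 - xy.2)%R)%E]; first by exists q.
move=> [x y] [z /= xz zy]; apply: qA => /=.
rewrite -(subrKA z); apply: lt_le_trans (val_add v _ _).
by rewrite lt_min xz zy.
Qed.

HB.instance Definition _ := GRing.Field.on (valued_field v).
HB.instance Definition _ := isPointed.Build (valued_field v) (0 : K).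
HB.instance Definition _ := isUniform.Build (valued_field v)
  val_entourage_filter val_entourage_diagonal val_entourage_inv
  val_entourage_split.

Definition val_complete : Prop :=
  forall A : set_system (valued_field v), ProperFilter A -> cauchy A -> cvg A.

Definition val_locally_compact : Prop := locally_compact [set: valued_field v].

Definition normalized_discrete : Prop :=
  v @` [set x | x != 0] = range (fun z : int => (z%:~R)%:E).

Definition valuation_ring : {pred K} := [pred x | (0 <= v x)%E].
Definition maximal_ideal : {pred K} := [pred x | (0 < v x)%E].

(* The ideal power: combinations, with coefficients in the valuation ring, of
   products of [nu] elements of the maximal ideal. *)
Definition maximal_ideal_pow (nu : nat) (x : K) : Prop :=
  exists2 s : seq (K * nu.-tuple K),
    forall t, t \in s -> t.1 \in valuation_ring /\ all maximal_ideal t.2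
  & x = \sum_(t <- s) t.1 * \prod_(a <- t.2) a.

Definition poly_congr (nu : nat) (F G : {poly K}) : Prop :=
  forall i, maximal_ideal_pow nu (F - G)`_i.

Definition unitO (p : {poly K}) : Prop :=
  exists2 q, q \is a polyOver valuation_ring & p * q = 1.

Definition irreducibleO (p : {poly K}) : Prop :=
  [/\ p \is a polyOver valuation_ring, p != 0, ~ unitO p &
      forall a b, a \is a polyOver valuation_ring ->
        b \is a polyOver valuation_ring -> p = a * b -> unitO a \/ unitO b].

End ValuationTopology.

Definition deg (R : nzRingType) (p : {poly R}) : nat := (size p).-1.

(* With the convention of [resultant], [resultant p q] is, for [q] monic, the
   product of the values of [p] at the roots of [q]. *)
Definition discriminant (R : comNzRingType) (F : {poly R}) : R :=
  (-1) ^+ 'C(deg F, 2) * resultant F^`() F.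

Section Okutsu.
Variables (k : fieldType) (kbar : fieldType) (iota : {rmorphism k -> kbar}).
Variables (v : valuation k) (vbar : valuation kbar).

Definition val_at (theta : kbar) (g : {poly k}) : \bar rat :=
  vbar (map_poly iota g).[theta].

(* A list [:: phi_1; ...; phi_r] is completed by phi_0 = 1, m_0 = 1 (although
   deg phi_0 = 0) and m_(r+1) = n. *)
Definition okutsu_phi (phis : seq {poly k}) (i : nat) : {poly k} :=
  nth 1 (1 :: phis) i.

Definition okutsu_m (n : nat) (phis : seq {poly k}) (i : nat) : nat :=
  nth 0%N (1%N :: rcons (map (@deg k) phis) n) i.

Definition okutsu_slope (n : nat) (theta : kbar) (phis : seq {poly k}) (i : nat)
    : \bar rat :=
  (val_at theta (okutsu_phi phis i) / ((okutsu_m n phis i)%:R)%:E)%E.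

Definition okutsu_frame (F : {poly k}) (theta : kbar) (phis : seq {poly k})
    : Prop :=
  let n := deg F in let r := size phis in
  [/\ forall phi, phi \in phis ->
        [/\ phi \is monic, phi \is a polyOver (valuation_ring v) &
            separable_poly phi],
      path ltn 0 (rcons (map (@deg k) phis) n),
      forall i, (i < r)%N ->
        (okutsu_slope n theta phis i < okutsu_slope n theta phis i.+1)%E &
      forall (i : nat) (g : {poly k}), (i <= r)%N ->
        g \is monic -> g \is a polyOver (valuation_ring v) ->
        (okutsu_m n phis i <= deg g < okutsu_m n phis i.+1)%N ->
        (val_at theta g / ((deg g)%:R)%:E <= okutsu_slope n theta phis i)%E].

Definition okutsu_delta0_at (F : {poly k}) (theta : kbar) (phis : seq {poly k})
    : \bar rat :=
  let n := deg F in let r := size phis in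
  ((n%:R / (okutsu_m n phis r)%:R)%:E * val_at theta (okutsu_phi phis r))%E.

(* For F monic, irreducible and separable this set is a singleton: frames exist,
   and the value depends neither on the frame nor on the root. The default 0 of
   [xget] is then not used. *)
Definition okutsu_delta0 (F : {poly k}) : \bar rat :=
  xget 0%E [set d | exists theta phis,
    [/\ root (map_poly iota F) theta, okutsu_frame F theta phis &
        d = okutsu_delta0_at F theta phis]].

(* [okutsu_equiv F G] : G is an Okutsu approximation to F. *)
Definition okutsu_equiv (F G : {poly k}) : Prop :=
  [/\ G \is monic, G \is a polyOver (valuation_ring v), deg G = deg F &
      forall theta, root (map_poly iota F) theta ->
        (okutsu_delta0 F < val_at theta G)%E].

End Okutsu.

(* Main.v *)
Require Import Defs.
From HB Require Import structures.
From mathcomp Require Import all_boot all_order all_algebra all_field.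
From mathcomp Require Import all_classical constructive_ereal topology.
From mathcomp Require Import lra ring zify.
Set Implicit Arguments.
Unset Strict Implicit.
Unset Printing Implicit Defensive.
Import Order.TTheory GRing.Theory Num.Theory.
Local Open Scope ring_scope.

(** Why the theorem holds. Write n for the common degree of F and G, and theta
    for a root of the polynomial that is known to be irreducible.

    Part (1). A frame of F bounds v(g(theta))/deg g by delta_0(F)/n for every
    monic integral g with 0 < deg g < n: the slopes of the frame increase, and
    delta_0(F)/n is the last one. Hence delta_0(F) < nu gives
    n v(g(theta)) < nu deg g for all such g ([slopes_below]), and the rest of
    the argument only uses this inequality. If G were a product of two monic
    factors of smaller degree, adding their inequalities would give
    v(G(theta)) < nu, although G(theta) = (G - F)(theta) has value at least nu
    ([perturb_irreducible]). If eta is a root of G, then F(eta) has value at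
    least nu for the same reason, so F is an Okutsu approximation to G as soon
    as delta_0(G) < nu. This follows from v(phi(eta)) = v(phi(theta)) for every
    monic integral separable phi of degree less than n ([perturb_ratval]). To
    see that, one may assume phi irreducible; by reciprocity of the double
    product over the roots, n v(phi(theta)) is deg phi times v(F(alpha)), where
    alpha is a root of phi; so v(F(alpha)) < nu, which forces
    v(G(alpha)) = v(F(alpha)), and reciprocity for G and phi concludes.

    Part (2). It is reduced to part (1) with F and G exchanged, that is, to the
    slope inequality for G. For an irreducible G with root eta, Lagrange
    interpolation writes a coefficient 1 of a monic g of degree less than n as a
    combination of the g(eta_i)/G'(eta_i), so that v(g(eta)) <= v(G'(eta))
    ([ratval_le_deriv]); applied to a power of g this shows that the slope
    inequality follows from 2 v(G'(eta)) < nu ([slopes_below_of_deriv]). Since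
    the discriminant of F is, up to sign, the product of the values of F' at the
    roots of F, its bound provides a root theta of F with 2 v(F'(theta)) < nu,
    and Newton approximation moves theta to a root eta of G with
    v(G'(eta)) = v(F'(theta)) ([close_root_deriv]).

    Two general facts carry these arguments. First, conjugate elements have the
    same value ([val_conj]); this is where completeness enters. If the values
    of a polynomial expression beta at the roots of an irreducible F were
    positive at some roots and negative at others, the inverses of 1 + beta^m
    modulo F would converge to a nontrivial idempotent of the field k[x]/(F).
    Second, Okutsu frames exist ([frame_below_exists]): the values v(g(theta))
    for monic g of a given degree are bounded and lie in (1/n)Z, so there are
    best approximations in each degree, and the degrees at which the slope
    reaches a new record form a frame. *)

(** * Valuations *)

Section Valuation.
Variables (K : fieldType) (v : valuation K).
Implicit Types (x y : K) (c : \bar rat).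

(** The value as a rational number; it is meaningful at nonzero arguments only,
    since [fine] sends the value +oo of 0 to 0. *)
Definition ratval x : rat := fine (v x).

Lemma ratvalE x : x != 0 -> v x = (ratval x)%:E.
Proof. by move=> x0; rewrite /ratval fineK // val_fin. Qed.

Lemma ratvalM x y : x != 0 -> y != 0 -> ratval (x * y) = ratval x + ratval y.
Proof. by move=> x0 y0; rewrite /ratval val_mul !ratvalE. Qed.

Lemma ratval1 : ratval 1 = 0. Proof. by rewrite /ratval val_one. Qed.

Lemma ratvalV x : x != 0 -> ratval x^-1 = - ratval x.
Proof.
move=> x0; apply: (@addrI _ (ratval x)); rewrite -ratvalM ?invr_eq0 //.
by rewrite divff // ratval1 subrr.
Qed.

Lemma ratvalX x m : x != 0 -> ratval (x ^+ m) = m%:R * ratval x.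
Proof.
move=> x0; elim: m => [|m IH]; first by rewrite expr0 ratval1 mul0r.
by rewrite exprS ratvalM ?expf_neq0 // IH -nat1r; ring.
Qed.

Lemma ratvalN x : ratval (- x) = ratval x.
Proof. by rewrite /ratval val_opp. Qed.

Lemma ratval_prod (I : eqType) (r : seq I) (F : I -> K) :
  (forall i, i \in r -> F i != 0) ->
  ratval (\prod_(i <- r) F i) = \sum_(i <- r) ratval (F i).
Proof.
elim: r => [|i r IH] F0; first by rewrite !big_nil ratval1.
rewrite !big_cons ratvalM ?IH ?F0 ?mem_head //.
  by move=> j jr; rewrite F0 // inE jr orbT.
by rewrite prodf_seq_neq0; apply/allP => j jr; rewrite F0 // inE jr orbT.
Qed.

Lemma val_ge_add c x y : (c <= v x -> c <= v y -> c <= v (x + y)%R)%E.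
Proof.
by move=> cx cy; apply: le_trans (val_add v x y); rewrite le_min cx cy.
Qed.

Lemma val_ge_sum c (I : eqType) (r : seq I) (F : I -> K) :
  (forall i, i \in r -> (c <= v (F i))%E) -> (c <= v (\sum_(i <- r) F i)%R)%E.
Proof.
move=> cF; rewrite big_seq; elim/big_rec: _ => [|i x /cF].
  by rewrite val_zero leey.
exact: val_ge_add.
Qed.

Lemma val_gt_add c x y : (c < v x -> c < v y -> c < v (x + y)%R)%E.
Proof.
by move=> cx cy; apply: lt_le_trans (val_add v x y); rewrite lt_min cx cy.
Qed.

Lemma val_gt_sum (q : rat) (I : eqType) (r : seq I) (F : I -> K) :
  (forall i, i \in r -> (q%:E < v (F i))%E) ->
  (q%:E < v (\sum_(i <- r) F i)%R)%E.
Proof.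
move=> qF; rewrite big_seq; elim/big_rec: _ => [|i x /qF].
  by rewrite val_zero ltry.
exact: val_gt_add.
Qed.

Lemma val_add_lt x y : (v x < v y -> v (x + y)%R = v x)%E.
Proof.
move=> xy; apply/le_anti/andP; split; last first.
  by apply: val_ge_add; rewrite // ltW.
rewrite leNgt; apply/negP => xxy.
suff: (v x < v x)%E by rewrite ltxx.
by rewrite -{2}[x](addrK y) val_gt_add // val_opp.
Qed.

Lemma val_ge_all0 x : (forall q : rat, (q%:E <= v x)%E) -> x = 0.
Proof.
move=> h; apply/eqP; apply: contraT => x0.
by have := h (ratval x + 1); rewrite ratvalE // lee_fin; lra.
Qed.

Lemma valuation_ring_subring : subring_closed (valuation_ring v).
Proof.
split=> [|x y|x y]; rewrite !inE ?val_one //.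
  by move=> x0 y0; apply: val_ge_add; rewrite ?val_opp.
by rewrite val_mul; apply: adde_ge0.
Qed.

HB.instance Definition _ :=
  GRing.isSubringClosed.Build K (valuation_ring v) valuation_ring_subring.

(** A root of negative value would make the leading term strictly dominate all
    the others. *)
Lemma val_root_ge0 (p : {poly K}) x :
  p \is monic -> p \is a polyOver (valuation_ring v) -> root p x ->
  x \in valuation_ring v.
Proof.
move=> pm /polyOverP pO px; rewrite inE leNgt; apply/negP => x_lt0.
have x0 : x != 0 by apply: contraTneq x_lt0 => ->; rewrite val_zero -leNgt leey.
move: x_lt0; rewrite ratvalE // lte_fin => x_lt0.
have := rootP px; rewrite horner_coef.
have szp : (0 < size p)%N by rewrite size_poly_gt0 monic_neq0.
have := monicP pm; rewrite lead_coefE -(prednK szp) /=.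
move: (size p).-1 => d lp; rewrite big_ord_recr /= lp mul1r addrC.
move=> /eqP; rewrite addr_eq0 => /eqP xd.
case: d lp xd => [|d] lp xd.
  by move/eqP: xd; rewrite big_ord0 expr0 oppr0 oner_eq0.
have : ((d%:R * ratval x)%R%:E <= v (x ^+ d.+1)%R)%E.
  rewrite xd val_opp; apply: val_ge_sum => i _; rewrite val_mul.
  rewrite -[leLHS]add0e leeD //; first exact: pO.
  rewrite ratvalE ?expf_neq0 // lee_fin ratvalX //.
  apply: ler_wnM2r; first exact: ltW.
  by rewrite ler_nat -ltnS.
rewrite ratvalE ?expf_neq0 // lee_fin ratvalX // -natr1 mulrDl mul1r.
by move: x_lt0; lra.
Qed.

End Valuation.

(** * Polynomials given by their roots *)

Section Roots.
Variable K : fieldType.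
Implicit Types (rs : seq K) (p q : {poly K}).

Definition cofactor_at rs (x : K) : {poly K} :=
  \prod_(y <- rs | y != x) ('X - y%:P).

Lemma horner_deriv_root rs x : uniq rs -> x \in rs ->
  (\prod_(y <- rs) ('X - y%:P))^`().[x] = (cofactor_at rs x).[x].
Proof.
move=> rsu xrs; rewrite (bigD1_seq x) //= derivM derivXsubC mul1r.
by rewrite !hornerE /= subrr mul0r addr0.
Qed.

Lemma horner_cofactor_eq0 rs x y : y \in rs -> y != x ->
  (cofactor_at rs x).[y] = 0.
Proof.
move=> yrs yx; rewrite /cofactor_at (big_rem y) //= yx.
by rewrite hornerM !hornerE subrr mul0r.
Qed.

Lemma horner_cofactor_neq0 rs x : (cofactor_at rs x).[x] != 0.
Proof.
rewrite /cofactor_at horner_prod prodf_seq_neq0; apply/allP => y _.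
by apply/implyP => yx; rewrite !hornerE subr_eq0 eq_sym.
Qed.

Lemma size_cofactor_le rs x : x \in rs -> (size (cofactor_at rs x) <= size rs)%N.
Proof.
move=> xrs; rewrite /cofactor_at -big_filter size_prod_XsubC size_filter.
rewrite -(count_predC (predC1 x) rs) -addn1 leq_add2l -has_count.
by apply/hasP; exists x => //=; rewrite eqxx.
Qed.

(** The source of every estimate below that passes from the values of a
    polynomial at the roots of F to its coefficients. *)
Lemma lagrange_expansion rs p : uniq rs -> (size p <= size rs)%N ->
  p = \sum_(x <- rs)
        (p.[x] / (\prod_(y <- rs) ('X - y%:P))^`().[x]) *: cofactor_at rs x.
Proof.
move=> rsu szp; apply/eqP; rewrite -subr_eq0; apply/eqP.
set s := \sum_(_ <- _) _.
apply: (@roots_geq_poly_eq0 _ _ rs) => //; last first.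
  rewrite (leq_trans (size_polyD _ _)) // geq_max szp size_polyN.
  rewrite /s big_seq; apply: (leq_trans (size_sum _ _ _)).
  apply/bigmax_leqP_seq => x _ xrs.
  by rewrite (leq_trans (size_scale_leq _ _)) // size_cofactor_le.
apply/allP => x xrs; rewrite rootE hornerD hornerN /s horner_sum.
rewrite (bigD1_seq x) //= hornerZ horner_deriv_root //.
rewrite divfK ?horner_cofactor_neq0 // big_seq_cond big1 ?addr0 ?subrr //.
move=> y /andP[_ xy]; rewrite hornerZ horner_cofactor_eq0 ?mulr0 //.
by rewrite eq_sym.
Qed.

(** The Lagrange expansion of the derivative itself, all of whose quotients are
    equal to 1. *)
Lemma deriv_prod_XsubC rs : uniq rs ->
  (\prod_(y <- rs) ('X - y%:P))^`() = \sum_(x <- rs) cofactor_at rs x.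
Proof.
move=> rsu; set P := \prod_(y <- rs) _.
have szP : (size P^`() <= size rs)%N.
  by rewrite -ltnS -(size_prod_XsubC rs id) lt_size_deriv // monic_neq0 ?monic_prod_XsubC.
rewrite {1}(lagrange_expansion rsu szP); apply: eq_big_seq => x xrs.
by rewrite divff ?scale1r // horner_deriv_root // horner_cofactor_neq0.
Qed.

(** Multiplying the Sylvester matrix by a Vandermonde matrix on the roots of q,
    completed by the unit vectors of the highest exponents, evaluates its rows
    at the roots. The rows that come from q vanish there, so the product is
    block triangular, with diagonal blocks a Vandermonde matrix scaled by the
    values of p and a unitriangular matrix. *)
Lemma resultant_prod_roots rs p : uniq rs -> p != 0 ->
  resultant p (\prod_(x <- rs) ('X - x%:P)) = \prod_(x <- rs) p.[x].
Proof.
move=> rsu p0; set q := \prod_(x <- rs) _.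
have szq : (size q).-1 = size rs by rewrite /q size_prod_XsubC.
have qm : q \is monic by rewrite /q monic_prod_XsubC.
have rq (i : 'I_(size q).-1) : root q rs`_i.
  by rewrite /q root_prod_XsubC mem_nth // -szq.
have -> : \prod_(x <- rs) p.[x] = \prod_(j < (size q).-1) p.[rs`_j].
  by rewrite (big_nth 0) big_mkord szq.
pose dq := (size q).-1; pose dp := (size p).-1; fold dq in rq |- *.
pose V := Vandermonde dq (\row_(j < dq) rs`_j).
pose W := Vandermonde (dq + dp) (\row_(j < dq) rs`_j).
(* The second block column reads off the coefficients of exponent at least
   deg q. *)
pose A : 'M[K]_(dq + dp) := row_mx W (col_mx 0 1%:M).
have detA : \det A = \det V.
  have -> : A = block_mx V 0 (dsubmx W) 1%:M.
    rewrite block_mxEh /A -{1}[W]vsubmxK; congr (row_mx (col_mx _ _) _).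
    by apply/matrixP => i j; rewrite !mxE.
  by rewrite det_lblock det1 mulr1.
have V0 : \det V != 0.
  rewrite det_Vandermonde; apply/prodf_neq0 => i _; apply/prodf_neq0 => j ij.
  rewrite !mxE subr_eq0 nth_uniq -?szq //.
  by rewrite eq_sym neq_ltn ij.
apply: (mulIf V0); rewrite -{1}detA /resultant -det_mulmx.
have Srow (r : {poly K}) m (i : 'I_m) j : (size r + m <= (dq + dp).+1)%N ->
    ((lin1_mx (poly_rV \o r \o* rVpoly) : 'M[K]_(m, dq + dp)) *m W) i j
      = r.[rs`_j] * rs`_j ^+ i.
  move=> szr; rewrite mxE.
  transitivity ((r * 'X^i).[rs`_j]); last first.
    by rewrite hornerM hornerXn.
  have sz : (size (r * 'X^i)%R <= dq + dp)%N.
    rewrite (leq_trans (size_polyMleq _ _)) // size_polyXn addnS /= -ltnS.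
    by rewrite (leq_trans _ szr) // -addnS leq_add2l.
  rewrite (horner_coef_wide _ sz); apply: eq_bigr => l _.
  by rewrite !mxE /= rVpoly_delta ['X^_ * r]mulrC.
have szp0 : (0 < size p)%N by rewrite size_poly_gt0.
have szq0 : (0 < size q)%N by rewrite size_poly_gt0 monic_neq0.
have szpdq : (size p + dq <= (dq + dp).+1)%N.
  by rewrite /dp -(prednK szp0) /= addSn addnC.
have szqdp : (size q + dp <= (dq + dp).+1)%N by rewrite /dq -{1}(prednK szq0).
rewrite /Sylvester_mx -/dq -/dp.
set Bp := lin1_mx _; set Bq := lin1_mx _.
have -> : col_mx Bp Bq *m A =
    block_mx (V *m diag_mx (\row_(j < dq) p.[rs`_j])) (Bp *m col_mx 0 1%:M)
             0 (Bq *m col_mx 0 1%:M) :> 'M_(dq + dp).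
  rewrite /A mul_mx_row !mul_col_mx block_mxEh; congr (row_mx (col_mx _ _) _).
    apply/matrixP => i j; rewrite Srow // mul_mx_diag !mxE.
    by rewrite mulrC.
  apply/matrixP => i j; rewrite Srow // !mxE.
  by rewrite (rootP (rq j)) mul0r.
rewrite det_ublock det_mulmx det_diag.
have -> : \det (Bq *m col_mx 0 1%:M) = 1.
  have BqE i j : (Bq *m col_mx 0 1%:M) i j = (q * 'X^i)`_(dq + j).
    rewrite -[Bq]hsubmxK mul_row_col mulmx0 add0r mulmx1 !mxE /=.
    by rewrite rVpoly_delta mulrC.
  rewrite det_trig.
    rewrite big1 // => i _; rewrite BqE coefMXn ltnNge leq_addl /= addnK.
    by rewrite /dq -lead_coefE (monicP qm).
  apply/is_trig_mxP => i j ij; rewrite BqE coefMXn ltnNge.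
  rewrite (leq_trans (ltnW ij) (leq_addl _ _)) /= nth_default //; move: ij.
  rewrite -(prednK szq0) -/dq => ij; rewrite -addnBA ?(ltnW ij) //.
  by rewrite -[X in (X < _)%N]addn0 ltn_add2l subn_gt0.
rewrite mulr1 mulrC; congr (_ * _).
by apply: eq_bigr => j _; rewrite mxE.
Qed.

End Roots.

Lemma resultant_map (K L : fieldType) (f : {rmorphism K -> L}) (p q : {poly K}) :
  resultant (map_poly f p) (map_poly f q) = f (resultant p q).
Proof.
rewrite /resultant -det_map_mx /Sylvester_mx !size_map_poly.
congr (\det _); rewrite map_col_mx.
by congr (col_mx _ _); apply/matrixP => i j; rewrite !mxE /= !rVpoly_delta
  !coefXnM; case: ifP => _; rewrite ?rmorph0 ?coef_map.
Qed.

Section ValuedInterpolation.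
Variables (K : fieldType) (v : valuation K).

(** In the Lagrange expansion the cofactors have integral coefficients, so only
    the quotients matter. *)
Lemma interpolation_val_ge (rs : seq K) (p : {poly K}) (c : \bar rat) j :
  uniq rs -> {subset rs <= valuation_ring v} -> (size p <= size rs)%N ->
  (forall x, x \in rs ->
     (c <= v (p.[x] / (\prod_(y <- rs) ('X - y%:P))^`().[x])%R)%E) ->
  (c <= v p`_j)%E.
Proof.
move=> rsu rsO szp hp; rewrite (lagrange_expansion rsu szp) coef_sum.
apply: val_ge_sum => x xrs; rewrite coefZ val_mul -[leLHS]adde0.
rewrite leeD ?hp //.
have /polyOverP/(_ j) : cofactor_at rs x \is a polyOver (valuation_ring v).
  rewrite /cofactor_at big_seq_cond rpred_prod // => y /andP[yrs _].
  by rewrite polyOverXsubC rsO.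
by rewrite inE.
Qed.

Lemma horner_val_ge (p : {poly K}) x (c : \bar rat) :
  (forall j, (c <= v p`_j)%E) -> x \in valuation_ring v ->
  (c <= v p.[x])%E.
Proof.
move=> cp xO; rewrite horner_coef; apply: val_ge_sum => j _.
by rewrite val_mul -[leLHS]adde0 leeD //; have := rpredX j xO; rewrite inE.
Qed.

(** The difference is x - y times an integral element. *)
Lemma val_horner_sub (p : {poly K}) x y : p \is a polyOver (valuation_ring v) ->
  x \in valuation_ring v -> y \in valuation_ring v ->
  (v (x - y)%R <= v (p.[x] - p.[y])%R)%E.
Proof.
move=> /polyOverP pO xO yO; rewrite !horner_coef -sumrB.
apply: val_ge_sum => i _.
rewrite -mulrBr subrXX mulrCA val_mul -[leLHS]adde0 leeD //.
have : p`_i * (\sum_(j < i) x ^+ (i.-1 - j) * y ^+ j) \in valuation_ring v.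
  by rewrite rpredM ?rpred_sum // => j _; rewrite rpredM ?rpredX.
by rewrite inE.
Qed.

End ValuedInterpolation.

(** * Elementary bounds *)

Lemma seq_upper_bound (T : eqType) (s : seq T) (f : T -> rat) :
  exists B, forall x, x \in s -> f x <= B.
Proof.
elim: s => [|a s [B hB]]; first by exists 0.
exists (Num.max (f a) B) => x; rewrite inE le_max => /orP[/eqP->|/hB ->].
  by rewrite lexx.
by rewrite orbT.
Qed.

(** Bisection: each element of s misses one half of the interval. *)
Lemma rat_between_avoid (s : seq rat) (a b : rat) : a < b ->
  exists t, [/\ a < t, t < b & t \notin s].
Proof.
elim: s a b => [|c s IH] a b ab.
  by exists ((a + b) / 2); split; rewrite ?in_nil //; lra.
have [cm|mc] := leP c ((a + b) / 2).
  have [|t [t1 t2 ts]] := IH ((a + b) / 2) b; first lra.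
  by exists t; rewrite inE negb_or ts andbT; split=> //; [lra|lra].
have [|t [t1 t2 ts]] := IH a ((a + b) / 2); first lra.
by exists t; rewrite inE negb_or ts andbT; split=> //; lra.
Qed.

(** * Completeness for sequences *)

Section Complete.
Variables (k : fieldType) (v : valuation k).

(** Completeness is stated with filters; it is applied here to the filter of the
    sets that contain a tail of the sequence. *)
Lemma val_complete_seq (hc : val_complete v) (u : nat -> k) :
  (forall q : rat, exists N, forall m m', (N <= m)%N -> (N <= m')%N ->
     (q%:E <= v (u m - u m')%R)%E) ->
  exists l, forall q : rat, exists N, forall m, (N <= m)%N ->
     (q%:E <= v (u m - l)%R)%E.
Proof.
move=> uC; pose A := [set B : set (valued_field v) |
  exists N, forall m, (N <= m)%N -> B (u m : valued_field v)]%classic.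
have AF : ProperFilter A.
  apply: Build_ProperFilter_ex.
    by move=> B [N hN]; exists (u N); apply: hN.
  split.
  - by exists 0%N.
  - move=> B C [N hN] [M hM]; exists (maxn N M) => m; rewrite geq_max.
    by move=> /andP[Nm Mm]; split; [apply: hN|apply: hM].
  - by move=> B C BC [N hN]; exists N => m /hN /BC.
have Ac : cauchy A.
  move=> B [q qB]; have [N hN] := uC (q + 1).
  (* A tail of the sequence is small of order q. *)
  have AN : A [set x | exists2 m, (N <= m)%N & x = u m]%classic.
    by exists N => m Nm; exists m.
  exists ([set x | exists2 m, (N <= m)%N & x = u m]%classic,
          [set x | exists2 m, (N <= m)%N & x = u m]%classic) => //.
  move=> [x y] /= [[m Nm ->] [m' Nm' ->]]; apply: qB => /=.
  by apply: lt_le_trans (hN _ _ Nm Nm'); rewrite lte_fin; lra.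
have /cvg_ex[l Al] := hc A AF Ac.
exists (l : k) => q.
have [|N hN] := Al (xsection [set xy | (q%:E < v (xy.1 - xy.2)%R)%E]%classic l).
  by apply: nbhs_entourage; exists q.
exists N => m /hN /xsectionP /= lum.
by rewrite -opprB val_opp; apply: ltW.
Qed.
End Complete.

(** * Monic factorizations *)

Lemma nat_bounded_max (P : nat -> Prop) B : (exists m, P m) ->
  (forall m, P m -> (m <= B)%N) -> exists2 m, P m & forall l, P l -> (l <= m)%N.
Proof.
move=> [m0 Pm0] PB.
have [||m /asboolP Pm mmax] := @ex_maxnP (fun m => `[< P m >]) B.
- by exists m0; apply/asboolP.
- by move=> m /asboolP; apply: PB.
by exists m => // l Pl; apply/mmax/asboolP.
Qed.

Lemma inve_natr m : (0 < m)%N -> ((m%:R : rat)%:E^-1 = ((m%:R)^-1)%R%:E)%E.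
Proof. by case: m => // m _; rewrite inver pnatr_eq0. Qed.

Lemma unitO_size (k : fieldType) (v : valuation k) (p : {poly k}) :
  unitO v p -> size p = 1%N.
Proof.
move=> [q _ pq]; have := congr1 (fun r => size (r : {poly k})) pq.
have [->|p0] := eqVneq p 0; first by rewrite mul0r size_poly0 size_poly1.
have [->|q0] := eqVneq q 0; first by rewrite mulr0 size_poly0 size_poly1.
rewrite size_mul // size_poly1.
move: p0 q0; rewrite -!size_poly_gt0; case: (size p) (size q) => [|m] [|l] //; lia.
Qed.

Lemma deg_addl (R : nzRingType) (p q : {poly R}) : (size q < size p)%N ->
  deg (p + q) = deg p.
Proof. by move=> qp; rewrite /deg size_polyDl. Qed.

Lemma deg_monicM (k : fieldType) (a b : {poly k}) : a \is monic -> b \is monic ->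
  deg (a * b) = (deg a + deg b)%N.
Proof.
move=> am bm; have a0 := monic_neq0 am; have b0 := monic_neq0 bm.
rewrite /deg size_mul //; move: a0 b0; rewrite -!size_poly_gt0.
by case: (size a) (size b) => [|m] [|l] //; lia.
Qed.

Lemma monic_deg0 (k : fieldType) (a : {poly k}) : a \is monic -> deg a = 0%N -> a = 1.
Proof.
move=> am a0; have /size1_polyC aC : (size a <= 1)%N.
  by move: a0; rewrite /deg; case: (size a) => [|[]].
by move/monicP: am; rewrite aC lead_coefC => ->.
Qed.

Lemma irreducible_deg_gt0 (k : fieldType) (F : {poly k}) :
  irreducible_poly F -> (0 < deg F)%N.
Proof. by case; rewrite /deg; case: (size F) => [|[]]. Qed.

Lemma monic_dvd_split (k : fieldType) (F q : {poly k}) : F \is monic -> q %| F ->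
  exists a b, [/\ a \is monic, b \is monic, F = a * b & a %= q].
Proof.
move=> Fm /dvdpP[r Fr]; have F0 := monic_neq0 Fm.
have q0 : lead_coef q != 0.
  by rewrite lead_coef_eq0; apply: contraNneq F0 => q0; rewrite Fr q0 mulr0.
have lrq : lead_coef r * lead_coef q = 1.
  by rewrite -lead_coefM -Fr (monicP Fm).
exists ((lead_coef q)^-1 *: q), (lead_coef q *: r); split.
- by rewrite monicE lead_coefZ mulVf.
- by rewrite monicE lead_coefZ mulrC lrq.
- by rewrite -scalerAl -scalerAr scalerA mulVf // scale1r mulrC.
- by rewrite eqp_scale // invr_eq0.
Qed.

Lemma monic_reducible_split (k : fieldType) (F : {poly k}) : F \is monic ->
  (0 < deg F)%N -> ~ irreducible_poly F ->
  exists a b, [/\ a \is monic, b \is monic, F = a * b,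
    (0 < deg a < deg F)%N & (0 < deg b < deg F)%N].
Proof.
move=> Fm dF nirr.
have [q [szq qF nq]] : exists q : {poly k},
    [/\ size q != 1%N, q %| F & ~~ (q %= F)].
  apply: contrapT => nex; apply: nirr; split.
    by move: dF; rewrite /deg; case: (size F) => [|[]].
  by move=> q szq qF; apply: contraT => nq; case: nex; exists q.
have [a [b [am bm Fab aq]]] := monic_dvd_split Fm qF.
have da : (0 < deg a)%N.
  rewrite lt0n; apply: contraNneq szq => a0.
  by rewrite -(eqp_size aq) (monic_deg0 am a0) size_poly1.
have db : (0 < deg b)%N.
  rewrite lt0n; apply: contraNneq nq => b0.
  by rewrite Fab (monic_deg0 bm b0) mulr1 eqp_sym.
exists a, b; split=> //; rewrite ?da ?db Fab deg_monicM //=.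
  by rewrite -[ltnLHS]addn0 ltn_add2l.
by rewrite -[ltnLHS]add0n ltn_add2r.
Qed.

(** * Extension of the valuation to an algebraically closed field *)

Section Extension.
Variables (k : fieldType) (v : valuation k).
Hypothesis hdisc : normalized_discrete v.
Hypothesis hcomplete : val_complete v.
Variables (kbar : closedFieldType) (iota : {rmorphism k -> kbar}).
Variable vbar : valuation kbar.
Hypothesis hext : forall x : k, vbar (iota x) = v x.
Local Notation "p ^^" := (map_poly iota p) (at level 2, format "p ^^").
Local Notation val_at := (val_at iota vbar).
Local Notation slope := (okutsu_slope iota vbar).

Lemma polyOver_map p : p \is a polyOver (valuation_ring v) ->
  p^^ \is a polyOver (valuation_ring vbar).
Proof.
move=> /polyOverP pO; apply/polyOverP => i; rewrite coef_map inE /= hext.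
exact: pO.
Qed.

Lemma root_in_valuation_ring (F : {poly k}) x : F \is monic ->
  F \is a polyOver (valuation_ring v) -> root F^^ x -> x \in valuation_ring vbar.
Proof.
by move=> Fm FO; apply: val_root_ge0; rewrite ?map_monic // polyOver_map.
Qed.

Lemma horner_in_valuation_ring (g : {poly k}) x : g \is a polyOver (valuation_ring v) ->
  x \in valuation_ring vbar -> g^^.[x] \in valuation_ring vbar.
Proof. by move=> gO xO; apply: rpred_horner => //; apply: polyOver_map. Qed.

Lemma monic_split (F : {poly k}) : F \is monic ->
  exists2 rs : seq kbar, F^^ = \prod_(x <- rs) ('X - x%:P) & size rs = deg F.
Proof.
move=> Fm; have [rs Frs] := closed_field_poly_normal F^^.
exists rs; first by rewrite Frs lead_coef_map (monicP Fm) rmorph1 scale1r.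
have := congr1 (fun p => size (p : {poly _})) Frs.
rewrite size_map_poly lead_coef_map (monicP Fm) rmorph1 scale1r.
by rewrite size_prod_XsubC /deg => ->.
Qed.

Lemma separable_split (F : {poly k}) : F \is monic -> separable_poly F ->
  exists rs : seq kbar,
    [/\ uniq rs, F^^ = \prod_(x <- rs) ('X - x%:P), size rs = deg F &
        forall x, (x \in rs) = root F^^ x].
Proof.
move=> Fm Fs; have [rs Frs szrs] := monic_split Fm; exists rs; split=> //.
  by rewrite -separable_prod_XsubC -Frs separable_map.
by move=> x; rewrite Frs root_prod_XsubC.
Qed.

Lemma exists_root (F : {poly k}) : (0 < deg F)%N -> exists x, root F^^ x.
Proof.
move=> dF; apply/closed_rootP; rewrite size_map_poly; move: dF; rewrite /deg.
by case: (size F) => [|[]].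
Qed.

(** A polynomial of degree less than deg F is determined by its values at the
    roots of F, and its coefficients are bounded in terms of these values. So
    if the values converge, the coefficients form Cauchy sequences in k, and
    the limit polynomial takes the limit values. *)
Lemma interpolation_closed (F : {poly k}) (e : nat -> {poly k})
    (E : kbar -> kbar) :
  F \is monic -> F \is a polyOver (valuation_ring v) -> separable_poly F ->
  (forall m, (size (e m) <= deg F)%N) ->
  (forall q : rat, exists N, forall m, (N <= m)%N -> forall x, root F^^ x ->
     (q%:E <= vbar ((e m)^^.[x] - E x)%R)%E) ->
  exists f : {poly k}, forall x, root F^^ x -> f^^.[x] = E x.
Proof.
move=> Fm FO Fs sze eE; have [rs [rsu Frs szrs rsP]] := separable_split Fm Fs.
have rsO : {subset rs <= valuation_ring vbar}.
  by move=> x; rewrite rsP; apply: root_in_valuation_ring.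
pose d x := (\prod_(y <- rs) ('X - y%:P))^`().[x].
have d0 x : x \in rs -> d x != 0.
  by move=> xrs; rewrite /d horner_deriv_root // horner_cofactor_neq0.
have [B hB] := seq_upper_bound rs (fun x => ratval vbar (d x)).
have eC (q : rat) : exists N, forall m m', (N <= m)%N -> (N <= m')%N ->
    forall j, (q%:E <= v ((e m)`_j - (e m')`_j)%R)%E.
  (* Dividing by F'(x) costs at most B. *)
  have [N hN] := eE (q + B); exists N => m m' Nm Nm' j.
  have -> : v ((e m)`_j - (e m')`_j) = vbar ((e m)^^ - (e m')^^)`_j.
    by rewrite coefB !coef_map -rmorphB hext.
  apply: (@interpolation_val_ge _ vbar rs) => //.
    rewrite szrs (leq_trans (size_polyD _ _)) // size_polyN !size_map_poly.
    by rewrite geq_max !sze.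
  move=> x xrs; rewrite -/(d x) val_mul [vbar (d x)^-1]ratvalE ?invr_eq0 ?d0 //.
  rewrite ratvalV ?d0 // EFinN leeBrDr // -EFinD.
  have xF : root F^^ x by rewrite -rsP.
  have -> : ((e m)^^ - (e m')^^).[x] =
     ((e m)^^.[x] - E x) - ((e m')^^.[x] - E x) by rewrite hornerD hornerN; ring.
  apply: (@le_trans _ _ ((q + B)%:E)%E); first by rewrite lee_fin lerD2l hB.
  by apply: val_ge_add; rewrite ?val_opp hN.
have /choice[l hl] j : exists l, forall q : rat, exists N, forall m, (N <= m)%N ->
     (q%:E <= v ((e m)`_j - l)%R)%E.
  apply: (val_complete_seq hcomplete) => q; have [N hN] := eC q.
  by exists N => m m' Nm Nm'; apply: hN.
exists (\poly_(j < deg F) l j) => x xF; apply/eqP; rewrite -subr_eq0; apply/eqP.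
apply: val_ge_all0 => q; have [N1 hN1] := eE q.
have /choice[N2 hN2] j := hl j q.
pose m := maxn N1 (\max_(j < deg F) N2 j).
have -> : (\poly_(j < deg F) l j)^^.[x] - E x =
   - (e m - \poly_(j < deg F) l j)^^.[x] + ((e m)^^.[x] - E x).
  by rewrite rmorphB hornerD hornerN; ring.
apply: val_ge_add; last by apply: hN1 xF; apply: leq_maxl.
rewrite val_opp; apply: horner_val_ge; last by rewrite rsO ?rsP.
move=> j; rewrite coef_map hext coefB coef_poly; case: ltnP => jF.
  apply: hN2; rewrite leq_max.
  by rewrite (leq_bigmax (F := fun j : 'I_(deg F) => N2 j) (Ordinal jF)) orbT.
by rewrite nth_default ?subrr ?val_zero ?leey // (leq_trans (sze m)).
Qed.

Lemma irreducible_root_dvd (F e : {poly k}) x : irreducible_poly F ->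
  root F^^ x -> root e^^ x -> F %| e.
Proof.
move=> [_ Firr] xF xe; have [|/Firr gF] := boolP (coprimep F e); last first.
  by rewrite -(eqp_dvdl _ (gF (dvdp_gcdl _ _))) dvdp_gcdr.
by rewrite -(coprimep_map iota) => /coprimep_root/(_ xF); rewrite (rootP xe) eqxx.
Qed.

Lemma irreducible_zero_conj (F e : {poly k}) x y : irreducible_poly F ->
  root F^^ x -> root F^^ y -> e^^.[x] = 0 -> e^^.[y] = 0.
Proof.
move=> Firr xF yF ex; have := irreducible_root_dvd Firr xF (introT eqP ex).
by rewrite -(dvdp_map iota) => /dvdpP[r ->]; rewrite hornerM (rootP yF) mulr0.
Qed.

(** If beta(z) has positive value then 1/(1 + beta(z)^m) tends to 1, and if it has
    negative value then it tends to 0. The polynomials of degree less than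
    deg F that represent these inverses modulo F therefore converge at every
    root, to a polynomial over k with the value 1 at x and 0 at y; this is
    impossible, as F divides any polynomial with which it shares a root. *)
Lemma irreducible_no_separation (F beta : {poly k}) x y :
  F \is monic -> F \is a polyOver (valuation_ring v) -> separable_poly F ->
  irreducible_poly F -> root F^^ x -> root F^^ y ->
  (forall z, root F^^ z -> (beta^^.[z] != 0) && (ratval vbar beta^^.[z] != 0)) ->
  0 < ratval vbar beta^^.[x] -> ratval vbar beta^^.[y] < 0 -> False.
Proof.
move=> Fm FO Fs Firr xF yF b0 bx by_.
pose w z := ratval vbar beta^^.[z].
have w0 z : root F^^ z -> w z != 0 by move=> /b0/andP[].
pose h m := 1 + beta ^+ m.+1.
have bX m z : root F^^ z -> ratval vbar (beta^^.[z] ^+ m.+1) = m.+1%:R * w z.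
  by move=> /b0/andP[bz _]; rewrite ratvalX.
have bX0 m z : root F^^ z -> beta^^.[z] ^+ m.+1 != 0.
  by move=> /b0/andP[bz _]; rewrite expf_neq0.
have hE m z : (h m)^^.[z] = 1 + beta^^.[z] ^+ m.+1.
  by rewrite rmorphD rmorph1 rmorphXn /= hornerD hornerE horner_exp.
have hv m z : root F^^ z ->
    vbar (h m)^^.[z] = (if 0 < w z then 0 else m.+1%:R * w z)%:E.
  move=> zF; rewrite hE; case: ltP => wz.
    rewrite val_add_lt val_one // ratvalE ?bX0 // lte_fin bX //.
    by rewrite mulr_gt0 ?ltr0n.
  rewrite addrC val_add_lt ratvalE ?bX0 // ?bX // val_one lte_fin.
  by rewrite pmulr_rlt0 ?ltr0n // lt_neqAle w0.
have h0 m z : root F^^ z -> (h m)^^.[z] != 0.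
  by move=> zF; apply/eqP => hz; have := hv m z zF; rewrite hz val_zero.
have /choice[e he] m : exists e : {poly k}, (size e <= deg F)%N /\
    forall z, root F^^ z -> e^^.[z] = ((h m)^^.[z])^-1.
  have : coprimep F (h m).
    apply: contraT => nc; have [_ /(_ _ nc (dvdp_gcdl _ _)) gF] := Firr.
    have : F %| h m by rewrite -(eqp_dvdl _ gF) dvdp_gcdr.
    rewrite -(dvdp_map iota) => /dvdpP[r hr].
    by have := h0 m x xF; rewrite hr hornerM (rootP xF) mulr0 eqxx.
  move=> /Bezout_eq1_coprimepP[[a b] /= ab1].
  have F0 : F != 0 by rewrite monic_neq0.
  exists (b %% F); split.
    by rewrite -ltnS /deg prednK ?size_poly_gt0 // ltn_modp.
  move=> z zF; apply: (mulIf (h0 m z zF)); rewrite mulVf ?h0 //.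
  have := congr1 (fun p => p^^.[z]) ab1.
  rewrite rmorph1 hornerE rmorphD !rmorphM /= {1}[b](divp_eq b F).
  by rewrite rmorphD rmorphM !hornerE /= (rootP zF) !mulr0 !add0r.
(* A uniform rate of convergence: 1/B bounds all the absolute values of w from
   below. *)
have [rs [rsu Frs szrs rsP]] := separable_split Fm Fs.
have [B hB] := seq_upper_bound rs (fun z => `|w z|^-1).
have wB z : root F^^ z -> 1 <= B * `|w z|.
  move=> zF; rewrite -ler_pdivrMr ?normr_gt0 ?w0 // mul1r hB //.
  by rewrite rsP.
have B0 : 0 <= B.
  by apply: le_trans (hB x _); rewrite ?rsP // invr_ge0.
have [] // := @interpolation_closed F e (fun z => if 0 < w z then 1 else 0).
- by move=> m; case: (he m).
- move=> q; exists (Num.bound (`|q| * B)) => m Nm z zF.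
  have qm : q <= m.+1%:R * `|w z|.
    apply: le_trans (ler_norm q) _.
    apply: (@le_trans _ _ (`|q| * (B * `|w z|))).
      by rewrite ler_peMr ?wB.
    rewrite mulrA ler_wpM2r //.
    have : `|q| * B < (Num.bound (`|q| * B))%:R.
      by apply: archi_boundP; rewrite mulr_ge0.
    by move=> /ltW/le_trans; apply; rewrite ler_nat leqW.
  have [_ /(_ z zF) ->] := he m.
  have := hv m z zF; case: ltP => wz hvz.
    have -> : (h m)^^.[z]^-1 - 1 = - (beta^^.[z] ^+ m.+1 / (h m)^^.[z]).
      rewrite -{1}[1](divff (h0 m z zF)) -{1}[_^-1]mul1r -mulrBl -mulNr.
      by rewrite [X in 1 - X]hE; congr (_ * _); ring.
    rewrite val_opp val_mul ratvalE ?bX0 // bX //.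
    rewrite [vbar (_^-1)]ratvalE ?invr_eq0 ?h0 // ratvalV ?h0 //.
    by rewrite /ratval hvz /= oppr0 adde0 lee_fin -[w z]gtr0_norm.
  rewrite subr0 ratvalE ?invr_eq0 ?h0 // ratvalV ?h0 // /ratval hvz /=.
  by rewrite lee_fin -mulrN -[- w z]ler0_norm.
move=> f hf.
have fx : f^^.[x] = 1 by rewrite hf // bx.
have fy : f^^.[y] = 0 by rewrite hf // ltNge ltW.
have /eqP := irreducible_zero_conj Firr yF xF fy.
by rewrite fx oner_eq0.
Qed.

Lemma val_int (c : k) : c != 0 -> exists z : int, v c = (z%:~R)%:E.
Proof.
move=> c0; have : (v @` [set x | x != 0])%classic (v c) by exists c.
by rewrite hdisc => -[z _ <-]; exists z.
Qed.

Lemma exists_val_int (z : int) : exists2 c : k, c != 0 & v c = (z%:~R)%:E.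
Proof.
have : (range (fun z : int => (z%:~R : rat)%:E)) (z%:~R)%:E by exists z.
by rewrite -hdisc => -[c /= c0 cz]; exists c.
Qed.

(** If v(g(y)) < v(g(x)), choose a rational t = a/M strictly between them that
    differs from all the values v(g(z)), and c in k with v(c) = a. The polynomial
    g^M/c then has the value M (v(g(z)) - t) at z, which contradicts
    [irreducible_no_separation]. *)
Lemma val_conj_le (F g : {poly k}) x y :
  F \is monic -> F \is a polyOver (valuation_ring v) -> separable_poly F ->
  irreducible_poly F -> root F^^ x -> root F^^ y ->
  (vbar g^^.[x] <= vbar g^^.[y])%E.
Proof.
move=> Fm FO Fs Firr xF yF; rewrite leNgt; apply/negP => gyx.
have g0 z : root F^^ z -> g^^.[z] != 0.
  move=> zF; apply/eqP => gz; move: gyx.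
  by rewrite (irreducible_zero_conj Firr zF yF) // val_zero ltNge leey.
move: gyx; rewrite !ratvalE ?g0 // lte_fin => gyx.
have [rs [rsu Frs szrs rsP]] := separable_split Fm Fs.
have [t [yt tx trs]] :=
  rat_between_avoid [seq ratval vbar g^^.[z] | z <- rs] gyx.
have [c c0 vc] := exists_val_int (numq t).
pose M := `|denq t|%N.
have tE : (numq t)%:~R = M%:R * t.
  rewrite /M natr_absz gtr0_norm ?denq_gt0 //.
  by rewrite -{3}[t]divq_num_den mulrC divfK // intr_eq0 denq_neq0.
have ci0 : iota c^-1 != 0 by rewrite fmorph_eq0 invr_eq0.
have M0 : (0 < M)%N by rewrite absz_gt0 denq_neq0.
have bE z : (c^-1 *: g ^+ M)^^.[z] = iota c^-1 * g^^.[z] ^+ M.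
  by rewrite map_polyZ hornerZ rmorphXn /= horner_exp.
have bv z : root F^^ z ->
    ratval vbar (c^-1 *: g ^+ M)^^.[z] = M%:R * (ratval vbar g^^.[z] - t).
  move=> zF; rewrite bE ratvalM ?expf_neq0 ?g0 // ratvalX ?g0 //.
  rewrite [ratval vbar (iota _)]/ratval hext -/(ratval v _) ratvalV //.
  by rewrite /ratval vc /= tE mulrBr addrC.
apply: (@irreducible_no_separation F (c^-1 *: g ^+ M) x y) => //.
- move=> z zF; rewrite bv // bE !mulf_neq0 ?expf_neq0 ?g0 ?pnatr_eq0 -?lt0n //.
  rewrite subr_eq0; apply: contraNneq trs => <-; apply/mapP; exists z => //.
  by rewrite rsP.
- by rewrite bv // mulr_gt0 ?ltr0n // subr_gt0.
- by rewrite bv // pmulr_rlt0 ?ltr0n // subr_lt0.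
Qed.

Lemma val_conj (F g : {poly k}) x y :
  F \is monic -> F \is a polyOver (valuation_ring v) -> separable_poly F ->
  irreducible_poly F -> root F^^ x -> root F^^ y ->
  vbar g^^.[x] = vbar g^^.[y].
Proof. by move=> *; apply/le_anti; rewrite !(val_conj_le (F := F)). Qed.

Section Irreducible.
Variable F : {poly k}.
Hypothesis Fm : F \is monic.
Hypothesis FO : F \is a polyOver (valuation_ring v).
Hypothesis Fs : separable_poly F.

Lemma root_deriv_neq0 x : root F^^ x -> F^`()^^.[x] != 0.
Proof.
move=> xF; have [rs [rsu Frs szrs rsP]] := separable_split Fm Fs.
by rewrite -deriv_map Frs horner_deriv_root ?rsP // horner_cofactor_neq0.
Qed.

Hypothesis Firr : irreducible_poly F.

(** Otherwise the irreducible F would divide g. *)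
Lemma root_small_neq0 (g : {poly k}) x : g != 0 -> (deg g < deg F)%N ->
  root F^^ x -> g^^.[x] != 0.
Proof.
move=> g0 gF xF; apply/negP => /(irreducible_root_dvd Firr xF) /dvdp_leq.
move=> /(_ g0) Fg; move: gF; rewrite ltnNge; apply/negP/negPn.
by rewrite /deg -!subn1 leq_sub2r.
Qed.

Lemma ratval_conj (g : {poly k}) x y : root F^^ x -> root F^^ y ->
  ratval vbar g^^.[x] = ratval vbar g^^.[y].
Proof. by move=> xF yF; rewrite /ratval
  (val_conj g Fm FO Fs Firr xF yF). Qed.

Lemma ratval_sum_roots (g : {poly k}) rs x :
  (forall z, (z \in rs) = root F^^ z) -> size rs = deg F -> root F^^ x ->
  (deg F)%:R * ratval vbar g^^.[x] = \sum_(z <- rs) ratval vbar g^^.[z].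
Proof.
move=> rsP szrs xF; rewrite big_seq.
rewrite (eq_bigr (fun _ => ratval vbar g^^.[x])) -?big_seq; last first.
  by move=> z; rewrite rsP => zF; apply: ratval_conj.
by rewrite big_const_seq count_predT szrs iter_addr_0 mulr_natl.
Qed.

(** The coefficient of exponent deg g in g is 1. By interpolation it is a
    combination, with integral coefficients, of the quotients g(z)/F'(z), all
    of which have the same value by conjugation; so this value is not positive. *)
Lemma ratval_le_deriv (g : {poly k}) x : g \is monic -> (deg g < deg F)%N ->
  root F^^ x -> ratval vbar g^^.[x] <= ratval vbar F^`()^^.[x].
Proof.
move=> gm gF xF; have [rs [rsu Frs szrs rsP]] := separable_split Fm Fs.
have rsO : {subset rs <= valuation_ring vbar}.
  by move=> z; rewrite rsP; apply: (root_in_valuation_ring Fm FO).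
have g0 z : root F^^ z -> g^^.[z] != 0.
  by apply: root_small_neq0; rewrite ?monic_neq0.
have := @interpolation_val_ge _ vbar rs g^^
  (ratval vbar g^^.[x] - ratval vbar F^`()^^.[x])%:E (deg g) rsu rsO.
have -> : g^^`_(deg g) = 1 by rewrite coef_map /= -lead_coefE (monicP gm) rmorph1.
rewrite val_one lee_fin subr_le0.
apply.
  rewrite szrs size_map_poly (leq_trans _ gF) // /deg prednK //.
  by rewrite size_poly_gt0 monic_neq0.
move=> z; rewrite rsP => zF; rewrite -Frs deriv_map.
have d0 := root_deriv_neq0 zF.
rewrite ratvalE ?mulf_neq0 ?invr_eq0 ?g0 // lee_fin ratvalM ?invr_eq0 ?g0 //.
rewrite ratvalV //.
by rewrite (ratval_conj g xF zF) (ratval_conj F^`() xF zF).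
Qed.

(** The product of the conjugates of g(x) is the resultant of g and F, an element
    of k. *)
Lemma ratval_root_int (g : {poly k}) x : g != 0 -> (deg g < deg F)%N ->
  root F^^ x -> exists z : int, (deg F)%:R * ratval vbar g^^.[x] = z%:~R.
Proof.
move=> g0 gF xF; have [rs [rsu Frs szrs rsP]] := separable_split Fm Fs.
have gz0 z : z \in rs -> g^^.[z] != 0 by rewrite rsP; apply: root_small_neq0.
have resE : iota (resultant g F) = \prod_(z <- rs) g^^.[z].
  by rewrite -resultant_map Frs resultant_prod_roots // map_poly_eq0.
have res0 : resultant g F != 0.
  rewrite -(fmorph_eq0 iota) resE prodf_seq_neq0; apply/allP => z zrs.
  by rewrite gz0.
have [z vz] := val_int res0; exists z.
by rewrite (ratval_sum_roots _ rsP) // -ratval_prod // -resE /ratval hext vz.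
Qed.

End Irreducible.

(** If g' = 0, the derivative of g + t X is the nonzero constant t. Otherwise
    g + t has a multiple root only if -t is the value of g at one of the finitely
    many roots of g', which fails once v(t) exceeds v(g(z)) at those roots z with
    g(z) nonzero. *)
Lemma separable_perturbation (g : {poly k}) (B : rat) : g \is monic ->
  g \is a polyOver (valuation_ring v) -> (0 < deg g)%N ->
  exists h : {poly k}, [/\ h \is monic, h \is a polyOver (valuation_ring v),
    separable_poly h, deg h = deg g & forall x, x \in valuation_ring vbar ->
      (B%:E <= vbar ((h - g)^^).[x])%E].
Proof.
move=> gm gO gdeg.
pose crit := sval (closed_field_poly_normal g^`()^^).
have [C hC] := seq_upper_bound crit (fun x => ratval vbar (- g^^.[x])).
have [t t0 vt] := exists_val_int (Num.bound (Num.max 0 (Num.max B C)) : int).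
have tB : Num.max 0 (Num.max B C) < (Num.bound (Num.max 0 (Num.max B C)) : int)%:~R.
  by apply: archi_boundP; rewrite le_max lexx.
set w := (Num.bound _ : int)%:~R in vt tB.
move: tB; rewrite !gt_max => /and3P[w0 wB wC].
have tO : t \in valuation_ring v by rewrite inE vt lee_fin ltW.
have monicD (p : {poly k}) : (size p < size g)%N -> g + p \is monic.
  by move=> pg; rewrite monicE lead_coefDl // (monicP gm).
have [gd|gd] := eqVneq g^`() 0.
  have dg : (size (t *: 'X : {poly k}) < size g)%N.
    rewrite size_scale // size_polyX; move: gdeg; rewrite /deg.
    case E : (size g) => [|[|[|m]]] // _.
    move/(congr1 (fun p : {poly k} => p`_0)): gd; rewrite coef_deriv coef0 mulr1n.
    have := monicP gm; rewrite lead_coefE E => -> /eqP.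
    by rewrite oner_eq0.
  exists (g + t *: 'X); split.
  - exact: monicD.
  - by rewrite rpredD // polyOverZ ?polyOverX.
  - rewrite separable_poly.unlock derivD gd add0r derivZ derivX.
    by rewrite coprimepZr ?coprimep1.
  - exact: deg_addl.
  - move=> x xO; rewrite addrC addKr map_polyZ hornerZ map_polyX hornerX val_mul hext vt.
    rewrite -[leLHS]adde0; apply: leeD; last exact: xO.
    by rewrite lee_fin ltW.
have dg : (size (t%:P : {poly k}) < size g)%N.
  by rewrite size_polyC t0; move: gdeg; rewrite /deg; case: (size g) => [|[]].
exists (g + t%:P); split.
- exact: monicD.
- by rewrite rpredD // polyOverC.
- rewrite separable_poly.unlock derivD derivC addr0 -(coprimep_map iota).
  rewrite coprimep_sym; apply/Pdiv.ClosedField.coprimepP => x xg'.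
  rewrite rmorphD hornerD /= map_polyC hornerC addrC -[X in _ + X]opprK subr_eq0.
  apply/eqP => tx; have /hC : x \in crit.
    rewrite /crit; case: (closed_field_poly_normal _) xg' => /= r {1}->.
    by rewrite rootZ ?root_prod_XsubC // lead_coef_eq0 map_poly_eq0.
  by rewrite -tx /ratval hext vt /=; lra.
- exact: deg_addl.
- move=> x xO; rewrite addrC addKr map_polyC hornerC hext vt.
  by rewrite lee_fin ltW.
Qed.

(** * Existence of Okutsu frames *)

Section Existence.
Variable F : {poly k}.
Hypothesis Fm : F \is monic.
Hypothesis FO : F \is a polyOver (valuation_ring v).
Hypothesis Fs : separable_poly F.
Hypothesis Firr : irreducible_poly F.
Variable x : kbar.
Hypothesis xF : root F^^ x.

(** The values v(g(x)) are bounded by [ratval_le_deriv] and lie in (1/n)Z by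
    [ratval_root_int], so their supremum is attained; a small perturbation makes
    the optimal g separable without changing its value. *)
Lemma best_approximant m : (0 < m < deg F)%N ->
  exists phi : {poly k}, [/\ phi \is monic, phi \is a polyOver (valuation_ring v),
    separable_poly phi, deg phi = m &
    forall g, g \is monic -> g \is a polyOver (valuation_ring v) -> deg g = m ->
      (val_at x g <= val_at x phi)%E].
Proof.
move=> /andP[m0 mF].
have xO : x \in valuation_ring vbar by apply: (root_in_valuation_ring Fm FO).
pose good (g : {poly k}) :=
  [/\ g \is monic, g \is a polyOver (valuation_ring v) & deg g = m].
have gx0 g : good g -> g^^.[x] != 0.
  move=> [gm gO gd]; apply: (root_small_neq0 Firr) => //.
    by rewrite monic_neq0.
  by rewrite gd.
have Fdeg0 : 0 < (deg F)%:R :> rat by rewrite ltr0n (leq_trans _ mF).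
pose P j := exists2 g, good g & (deg F)%:R * ratval vbar g^^.[x] = j%:R.
have goodP g : good g -> exists j, (deg F)%:R * ratval vbar g^^.[x] = j%:R.
  move=> gg; have [gm gO gd] := gg.
  have [||z hz] := ratval_root_int Fm FO Fs Firr (g := g) _ _ xF.
  - by rewrite monic_neq0.
  - by rewrite gd.
  have z0 : 0 <= z.
    rewrite -(ler0z rat) -hz mulr_ge0 ?ler0n // -lee_fin -ratvalE ?gx0 //.
    exact: (horner_in_valuation_ring gO xO).
  by exists `|z|%N; rewrite hz natr_absz ger0_norm.
have [||j [g gg gj] jmax] := @nat_bounded_max P
    (Num.bound ((deg F)%:R * `|ratval vbar F^`()^^.[x]|)).
- have gX : good 'X^m.
    by split; rewrite ?monicXn ?rpredX ?polyOverX // /deg size_polyXn.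
  by have [j hj] := goodP _ gX; exists j; exists ('X^m).
- move=> j [g gg gj]; have [gm gO gd] := gg.
  rewrite -(ler_nat rat) -gj; apply/ltW; apply: le_lt_trans (archi_boundP _); last first.
    by rewrite mulr_ge0 // ltW.
  rewrite ler_pM2l //; apply: le_trans (ler_norm _).
  by apply: (ratval_le_deriv Fm FO Fs Firr) => //; rewrite gd.
have [gm gO gd] := gg.
have [|h [hm hO hs hd hh]] :=
  separable_perturbation (ratval vbar g^^.[x] + 1) gm gO.
  by rewrite gd.
exists h; split=> //; first by rewrite hd.
have hg : vbar h^^.[x] = vbar g^^.[x].
  have -> : h^^.[x] = g^^.[x] + ((h - g)^^).[x].
    by rewrite -hornerD -rmorphD addrC subrK.
  apply: val_add_lt; rewrite ratvalE ?gx0 //.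
  by apply: lt_le_trans (hh x xO); rewrite lte_fin ltrDl.
move=> f fm fO fd; rewrite /Defs.val_at hg !ratvalE ?gx0 // lee_fin.
have [l hl] := goodP f (And3 fm fO fd).
rewrite -(ler_pM2l Fdeg0) gj hl ler_nat jmax //.
by exists f.
Qed.

(** The conditions of an Okutsu frame restricted to competitors of degree less
    than M; the case M = deg F is [okutsu_frame]. This makes an induction on M
    possible. *)
Definition frame_below M (phis : seq {poly k}) : Prop :=
  let r := size phis in
  [/\ forall phi, phi \in phis ->
        [/\ phi \is monic, phi \is a polyOver (valuation_ring v) &
            separable_poly phi],
      path ltn 0 (rcons (map (@deg k) phis) M),
      forall i, (i < r)%N -> (slope M x phis i < slope M x phis i.+1)%E &
      forall (i : nat) (g : {poly k}), (i <= r)%N ->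
        g \is monic -> g \is a polyOver (valuation_ring v) ->
        (okutsu_m M phis i <= deg g < okutsu_m M phis i.+1)%N ->
        (val_at x g / ((deg g)%:R)%:E <= slope M x phis i)%E].

Lemma okutsu_m_low M (phis : seq {poly k}) i : (i <= size phis)%N ->
  okutsu_m M phis i = nth 0%N (1%N :: map (@deg k) phis) i.
Proof.
move=> ir; rewrite /okutsu_m; case: i ir => //= i ir.
by rewrite nth_rcons size_map ir.
Qed.

Lemma okutsu_m_last M (phis : seq {poly k}) : okutsu_m M phis (size phis).+1 = M.
Proof. by rewrite /okutsu_m /= nth_rcons size_map ltnn eqxx. Qed.

(** The completing degree of the shorter list is the degree of the polynomial
    that is added, so both sequences of degrees agree up to this index. *)
Lemma okutsu_m_rcons M (phis : seq {poly k}) phi i : (i <= (size phis).+1)%N ->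
  okutsu_m M (rcons phis phi) i = okutsu_m (deg phi) phis i.
Proof.
move=> ir; rewrite okutsu_m_low ?size_rcons // /okutsu_m.
by rewrite map_rcons.
Qed.

Lemma okutsu_phi_rcons (phis : seq {poly k}) phi i : (i <= size phis)%N ->
  okutsu_phi (rcons phis phi) i = okutsu_phi phis i.
Proof.
by rewrite /okutsu_phi; case: i => //= i ir; rewrite nth_rcons ir.
Qed.

Lemma okutsu_phi_rcons_last (phis : seq {poly k}) phi :
  okutsu_phi (rcons phis phi) (size phis).+1 = phi.
Proof. by rewrite /okutsu_phi /= nth_rcons ltnn eqxx. Qed.

(** Going from M to M + 1 brings in the competitors of degree M. The best one, phi,
    is added to the list exactly if its slope exceeds the last slope. *)
Lemma frame_below_exists M : (0 < M <= deg F)%N -> exists phis, frame_below M phis.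
Proof.
elim: M => [//|M IH]; case: (posnP M) => [->|M0] MF.
  exists [::]; split=> // i g; rewrite leqn0 => /eqP-> _ _.
  by rewrite /okutsu_m /=; case: (deg g) => [|[]].
have [|phis [h1 h2 h3 h4]] := IH; first by rewrite M0 ltnW.
have [|phi [phim phiO phis_ phid phimax]] := @best_approximant M.
  by rewrite M0.
have slope_low N i : (i <= size phis)%N -> slope N x phis i = slope M x phis i.
  by move=> ir; rewrite /okutsu_slope !okutsu_m_low.
have [le|gt] := leP (val_at x phi / (M%:R)%:E)%E (slope M x phis (size phis)).
  exists phis; split=> //.
  - move: h2; rewrite !rcons_path => /andP[-> /=] /ltn_trans; apply.
    exact: ltnSn.
  - by move=> i ir; rewrite !slope_low ?(ltnW ir) // h3.
  move=> i g ir gm gO; rewrite slope_low //.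
  move: ir; rewrite leq_eqVlt => /orP[/eqP->|ir].
    rewrite okutsu_m_last ltnS => /andP[]; rewrite okutsu_m_low // => mg.
    rewrite leq_eqVlt => /orP[/eqP gM|gM].
      apply: le_trans le; rewrite gM lee_wpmul2r ?phimax //.
      by rewrite inve_natr // lee_fin invr_ge0.
    by apply: h4; rewrite // okutsu_m_last okutsu_m_low ?mg.
  rewrite !okutsu_m_low ?(ltnW ir) // => hg.
  by apply: h4; rewrite ?(ltnW ir) // !okutsu_m_low ?(ltnW ir).
have slope_rcons i : (i <= size phis)%N ->
    slope M.+1 x (rcons phis phi) i = slope M x phis i.
  move=> ir; rewrite /okutsu_slope okutsu_phi_rcons // okutsu_m_rcons ?leqW //.
  by rewrite !okutsu_m_low.
have slope_last : slope M.+1 x (rcons phis phi) (size phis).+1 =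
    (val_at x phi / (M%:R)%:E)%E.
  rewrite /okutsu_slope okutsu_phi_rcons_last okutsu_m_rcons //.
  by rewrite okutsu_m_last phid.
exists (rcons phis phi); split.
- by move=> p; rewrite mem_rcons inE => /orP[/eqP->|/h1].
- by rewrite map_rcons phid rcons_path h2 last_rcons /= ltnSn.
- move=> i; rewrite size_rcons ltnS leq_eqVlt => /orP[/eqP->|ir].
    by rewrite slope_last slope_rcons.
  by rewrite !slope_rcons ?(ltnW ir) // h3.
move=> i g; rewrite size_rcons leq_eqVlt => /orP[/eqP->|ir] gm gO.
  have -> : okutsu_m M.+1 (rcons phis phi) (size phis).+2 = M.+1.
    by rewrite -(size_rcons phis phi) okutsu_m_last.
  rewrite slope_last okutsu_m_rcons // okutsu_m_last phid ltnS => /anti_leq gM.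
  rewrite -gM lee_wpmul2r ?phimax //.
  by rewrite inve_natr // lee_fin invr_ge0.
have {}ir : (i <= size phis)%N by [].
rewrite slope_rcons // okutsu_m_rcons 1?leqW // okutsu_m_rcons // phid.
exact: h4.
Qed.

End Existence.

(** * Slopes and the Okutsu discriminant *)

(** The inequality v(g(x))/deg g < nu/deg F, without denominators. It is the
    form in which an upper bound nu of delta_0(F) is used. *)
Definition slopes_below (F : {poly k}) (x : kbar) (nu : nat) : Prop :=
  forall g : {poly k}, g \is monic -> g \is a polyOver (valuation_ring v) ->
    (0 < deg g < deg F)%N ->
    (deg F)%:R * ratval vbar g^^.[x] < (nu * deg g)%:R.

Lemma frame_last (phis : seq {poly k}) n :
  path ltn 0%N (rcons (map (@deg k) phis) n) ->
  phis = [::] \/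
  [/\ okutsu_phi phis (size phis) \in phis,
      okutsu_m n phis (size phis) = deg (okutsu_phi phis (size phis)) &
      (0 < deg (okutsu_phi phis (size phis)) < n)%N].
Proof.
case/lastP: phis => [|phis phi]; first by left.
rewrite map_rcons rcons_path last_rcons rcons_path => /andP[/andP[_ lphi] phin].
right; have -> : okutsu_phi (rcons phis phi) (size (rcons phis phi)) = phi.
  by rewrite size_rcons okutsu_phi_rcons_last.
split; first by rewrite mem_rcons mem_head.
  by rewrite size_rcons okutsu_m_rcons // okutsu_m_last.
by rewrite (leq_ltn_trans _ lphi).
Qed.

(** The degree of g lies in one of the intervals [m_i, m_(i+1)), and the slopes
    of a frame increase. *)
Lemma frame_slope_max (F : {poly k}) x phis (g : {poly k}) :
  okutsu_frame iota v vbar F x phis ->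
  g \is monic -> g \is a polyOver (valuation_ring v) -> (0 < deg g < deg F)%N ->
  (val_at x g / ((deg g)%:R)%:E <= slope (deg F) x phis (size phis))%E.
Proof.
move=> [_ _ mono best] gm gO /andP[g0 gF].
have slope_le d : (d <= size phis)%N ->
    (slope (deg F) x phis (size phis - d) <= slope (deg F) x phis (size phis))%E.
  elim: d => [|d IH] dr; first by rewrite subn0.
  apply: le_trans (IH (ltnW dr)); apply/ltW; rewrite -(subnSK dr).
  by apply: mono; rewrite ltn_subrL (leq_trans _ dr).
have exP : exists i, (deg g < okutsu_m (deg F) phis i.+1)%N.
  by exists (size phis); rewrite okutsu_m_last.
case: (ex_minnP exP) => i gi imin.
have ir : (i <= size phis)%N by apply: imin; rewrite okutsu_m_last.
apply: le_trans (best i g ir gm gO _) _.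
  rewrite gi andbT; case: i gi imin ir => [|i] _ imin _ //.
  by rewrite leqNgt; apply/negP => /imin; rewrite ltnn.
by rewrite -(subKn ir); apply: slope_le; rewrite leq_subr.
Qed.

Lemma delta0_at_slope (F : {poly k}) x phis :
  path ltn 0%N (rcons (map (@deg k) phis) (deg F)) ->
  okutsu_delta0_at iota vbar F x phis =
    ((deg F)%:R%:E * slope (deg F) x phis (size phis))%E.
Proof.
move=> /frame_last hp; rewrite /okutsu_delta0_at /okutsu_slope.
have m0 : (0 < okutsu_m (deg F) phis (size phis))%N.
  case: hp => [->|[_ -> /andP[]]] //.
by rewrite inve_natr // EFinM -muleA [(_^-1%:E * _)%E]muleC.
Qed.

(** The set in the definition of [okutsu_delta0] is nonempty, as frames exist; so
    the chosen value comes from some frame at some root, and conjugation carries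
    the inequality to all roots. *)
Lemma slopes_below_of_delta0 (F : {poly k}) (nu : nat) :
  F \is monic -> F \is a polyOver (valuation_ring v) -> separable_poly F ->
  irreducible_poly F -> (okutsu_delta0 iota v vbar F < (nu%:R)%:E)%E ->
  forall x, root F^^ x -> slopes_below F x nu.
Proof.
move=> Fm FO Fs Firr; have dF := irreducible_deg_gt0 Firr.
have [y0 y0F] := exists_root dF.
rewrite /okutsu_delta0; set A := (X in xget _ X).
have /(xgetPex 0%E)[y [phis [yF fr ->]]] : exists d, A d.
  have [|phis hphis] := frame_below_exists Fm FO Fs Firr y0F (M := deg F).
    by rewrite dF leqnn.
  by exists (okutsu_delta0_at iota vbar F y0 phis), y0, phis.
have [_ hpath _ _] := fr; rewrite delta0_at_slope // => dlt x xF g gm gO gd.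
have [g0 gF] := andP gd.
have gy0 : g^^.[y] != 0 by apply: (root_small_neq0 Firr); rewrite ?monic_neq0.
rewrite (ratval_conj Fm FO Fs Firr g xF yF).
have := frame_slope_max fr gm gO gd.
move=> /(@lee_wpmul2l _ (deg F)%:R%:E) h; have := le_lt_trans (h _) dlt.
rewrite lee_fin ler0n => /(_ isT).
rewrite /Defs.val_at ratvalE // inve_natr // -!EFinM lte_fin mulrA.
by rewrite ltr_pdivrMr ?ltr0n // natrM.
Qed.

(** Only the last polynomial of a frame matters, and it is separable of degree
    less than deg F. The value 0 occurs for an empty frame, and as the default
    of [xget]; nu is positive. *)
Lemma delta0_lt (F : {poly k}) (nu : nat) :
  F \is monic -> F \is a polyOver (valuation_ring v) ->
  irreducible_poly F -> (0 < nu)%N ->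
  (forall x, root F^^ x -> forall phi : {poly k}, phi \is monic ->
     phi \is a polyOver (valuation_ring v) -> separable_poly phi ->
     (0 < deg phi < deg F)%N ->
     (deg F)%:R * ratval vbar phi^^.[x] < (nu * deg phi)%:R) ->
  (okutsu_delta0 iota v vbar F < (nu%:R)%:E)%E.
Proof.
move=> Fm FO Firr nu0 hF; rewrite /okutsu_delta0; set A := (X in xget _ X).
have [Ane|nA] := pselect (exists d, A d); last first.
  by rewrite xgetPN ?lte_fin ?ltr0n // => d Ad; apply: nA; exists d.
have [x [phis [xF [h1 hpath _ _] ->]]] := xgetPex 0%E Ane.
rewrite /okutsu_delta0_at; have [->|[phiin -> phid]] := frame_last hpath.
  have -> : val_at x (okutsu_phi [::] 0) = 0%E.
    by rewrite /Defs.val_at /okutsu_phi /= rmorph1 hornerE val_one.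
  by rewrite mule0 lte_fin ltr0n.
have [phim phiO phis_] := h1 _ phiin.
have [phi0 phiF] := andP phid.
have gx0 : (okutsu_phi phis (size phis))^^.[x] != 0.
  by apply: (root_small_neq0 Firr); rewrite ?monic_neq0.
rewrite /Defs.val_at ratvalE // -EFinM lte_fin mulrAC ltr_pdivrMr ?ltr0n //.
by rewrite -natrM hF.
Qed.

(** With t the integral part of (n - 1)/deg g, the polynomial g^t has degree less
    than n, so t v(g(x)) <= v(F'(x)) < nu/2; and n <= 2 t deg g because t >= 1. *)
Lemma slopes_below_of_deriv (F : {poly k}) (nu : nat) x :
  F \is monic -> F \is a polyOver (valuation_ring v) -> separable_poly F ->
  irreducible_poly F -> root F^^ x -> 2 * ratval vbar F^`()^^.[x] < nu%:R ->
  slopes_below F x nu.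
Proof.
move=> Fm FO Fs Firr xF dF g gm gO /andP[g0 gF].
have xO := root_in_valuation_ring Fm FO xF.
have gx0 : g^^.[x] != 0 by apply: (root_small_neq0 Firr); rewrite ?monic_neq0.
have rg : 0 <= ratval vbar g^^.[x].
  rewrite -lee_fin -ratvalE //; exact: (horner_in_valuation_ring gO xO).
pose t := ((deg F).-1 %/ deg g)%N.
have t1 : (0 < t)%N by rewrite divn_gt0 // -ltnS prednK // (leq_trans _ gF).
have Ft : (deg F <= 2 * t * deg g)%N.
  have : ((deg F).-1 < t.+1 * deg g)%N by rewrite ltn_ceil.
  rewrite prednK ?(leq_trans _ gF) // => /leq_trans; apply.
  by rewrite leq_mul2r mul2n -addnn -addn1 leq_add2l t1 orbT.
have degX : deg (g ^+ t) = (t * deg g)%N.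
  by rewrite /deg size_exp mulnC.
have := ratval_le_deriv Fm FO Fs Firr (monic_exp t gm) _ xF.
rewrite degX rmorphXn /= horner_exp ratvalX // => le1.
have {}le1 : t%:R * ratval vbar g^^.[x] <= ratval vbar F^`()^^.[x].
  apply: le1; rewrite (leq_ltn_trans (leq_divM _ _)) //.
  by rewrite prednK // (leq_trans _ gF).
apply: (@le_lt_trans _ _ ((2 * t * deg g)%:R * ratval vbar g^^.[x])).
  by rewrite ler_wpM2r // ler_nat.
rewrite !natrM mulrAC ltr_pM2r ?ltr0n //; apply: le_lt_trans dF.
by rewrite -mulrA ler_pM2l.
Qed.

(** * Irreducibility over the valuation ring *)

(** The roots of a are roots of F, hence integral, and the coefficients of a are
    polynomials in its roots. *)
Lemma monic_factor_polyOver (F a : {poly k}) : F \is monic ->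
  F \is a polyOver (valuation_ring v) -> a \is monic -> a %| F ->
  a \is a polyOver (valuation_ring v).
Proof.
move=> Fm FO am aF; have [rs ars _] := monic_split am.
have aO : a^^ \is a polyOver (valuation_ring vbar).
  rewrite ars big_seq rpred_prod // => z zrs; rewrite polyOverXsubC.
  apply: (root_in_valuation_ring Fm FO).
  by move: aF; rewrite -(dvdp_map iota) => /root_dvdp; apply; rewrite ars root_prod_XsubC.
apply/polyOverP => i; have /polyOverP/(_ i) := aO.
by rewrite coef_map !inE /= hext.
Qed.

Lemma irreducibleO_irreducible_poly (F : {poly k}) : F \is monic ->
  F \is a polyOver (valuation_ring v) -> irreducibleO v F -> irreducible_poly F.
Proof.
move=> Fm FO [_ F0 nuF Firr]; split.
  rewrite ltnNge; apply/negP => szF; apply: nuF; exists 1; first exact: rpred1.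
  rewrite mulr1; apply: monic_deg0 => //; move: szF.
  by rewrite /deg; case: (size F) => [|[]].
move=> q szq qF; have [a [b [am bm Fab aq]]] := monic_dvd_split Fm qF.
have aO : a \is a polyOver (valuation_ring v).
  by apply: (monic_factor_polyOver Fm FO) => //; rewrite Fab dvdp_mulr.
have bO : b \is a polyOver (valuation_ring v).
  by apply: (monic_factor_polyOver Fm FO) => //; rewrite Fab dvdp_mull.
have [/unitO_size sza|/unitO_size szb] := Firr a b aO bO Fab.
  by move: szq; rewrite -(eqp_size aq) sza.
have b1 : b = 1 by apply: monic_deg0; rewrite // /deg szb.
by rewrite Fab b1 mulr1 eqp_sym.
Qed.

(** The leading coefficients of two integral factors of a monic polynomial are
    inverse units, so the factors can be made monic. *)
Lemma irreducibleO_of_monic (G : {poly k}) : G \is monic ->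
  G \is a polyOver (valuation_ring v) -> (0 < deg G)%N ->
  (forall a b, a \is monic -> b \is monic ->
     a \is a polyOver (valuation_ring v) -> b \is a polyOver (valuation_ring v) ->
     G = a * b -> (0 < deg a)%N -> (0 < deg b)%N -> False) ->
  irreducibleO v G.
Proof.
move=> Gm GO dG hG; split=> //; first exact: monic_neq0.
  by move=> /unitO_size; move: dG; rewrite /deg => + szG; rewrite szG.
move=> a b aO bO Gab.
have lab : lead_coef a * lead_coef b = 1 by rewrite -lead_coefM -Gab (monicP Gm).
have laO : lead_coef a \in valuation_ring v by rewrite lead_coefE; apply/polyOverP.
have lbO : lead_coef b \in valuation_ring v by rewrite lead_coefE; apply/polyOverP.
have am : lead_coef b *: a \is monic by rewrite monicE lead_coefZ mulrC lab.
have bm : lead_coef a *: b \is monic by rewrite monicE lead_coefZ lab.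
have Gab' : G = (lead_coef b *: a) * (lead_coef a *: b).
  by rewrite -scalerAl -scalerAr scalerA [lead_coef b * _]mulrC lab scale1r.
have unit_of c p : c \in valuation_ring v -> c *: p = 1 -> unitO v p.
  by move=> cO cp; exists c%:P; rewrite ?polyOverC // mulrC mul_polyC.
have [/eqP a0|a0] := posnP (deg (lead_coef b *: a)).
  by left; apply: (unit_of (lead_coef b)) => //; apply/monic_deg0/eqP.
have [/eqP b0|b0] := posnP (deg (lead_coef a *: b)).
  by right; apply: (unit_of (lead_coef a)) => //; apply/monic_deg0/eqP.
by case: (hG _ _ am bm) => //; rewrite polyOverZ.
Qed.

(** * Perturbation of an irreducible polynomial *)

(** By conjugation both sides are the sum of v(s - t) over all roots s of F and t
    of phi. *)
Lemma reciprocity (F phi : {poly k}) x y :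
  F \is monic -> F \is a polyOver (valuation_ring v) -> separable_poly F ->
  irreducible_poly F ->
  phi \is monic -> phi \is a polyOver (valuation_ring v) -> separable_poly phi ->
  irreducible_poly phi -> (deg phi < deg F)%N ->
  root F^^ x -> root phi^^ y ->
  (deg F)%:R * ratval vbar phi^^.[x] = (deg phi)%:R * ratval vbar F^^.[y].
Proof.
move=> Fm FO Fs Firr pm pO ps pirr dp xF yp.
have [rs [rsu Frs szrs rsP]] := separable_split Fm Fs.
have [ss [ssu pss szss ssP]] := separable_split pm ps.
have neq s t : s \in rs -> t \in ss -> s - t != 0.
  rewrite rsP ssP => sF; apply: contraTneq => /subr0_eq <-.
  by apply: (root_small_neq0 Firr); rewrite ?monic_neq0.
rewrite (ratval_sum_roots Fm FO Fs Firr phi rsP) //.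
rewrite (ratval_sum_roots pm pO ps pirr F ssP) //.
have evalE hs (H : {poly k}) z : H^^ = \prod_(t <- hs) ('X - t%:P) ->
    (forall t, t \in hs -> z - t != 0) ->
    ratval vbar H^^.[z] = \sum_(t <- hs) ratval vbar (z - t).
  move=> -> nz; rewrite horner_prod -ratval_prod //; congr (ratval _ _).
  by apply: eq_bigr => t _; rewrite hornerXsubC.
rewrite big_seq (eq_bigr (fun s => \sum_(t <- ss) ratval vbar (s - t))); last first.
  by move=> s srs; apply: evalE => // t; apply: neq.
rewrite -big_seq exchange_big /= [RHS]big_seq.
rewrite [RHS](eq_bigr (fun t => \sum_(s <- rs) ratval vbar (t - s))) -?big_seq.
  by apply: eq_bigr => t _; apply: eq_bigr => s _; rewrite -ratvalN opprB.
by move=> t tss; apply: evalE => // s srs; rewrite -oppr_eq0 opprB neq.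
Qed.

(** The coefficientwise congruence modulo the power nu of the maximal ideal,
    expressed by the valuation. *)
Definition val_congr (nu : nat) (F G : {poly k}) : Prop :=
  forall i, ((nu%:R)%:E <= v (F - G)`_i)%E.

(** Nonzero elements of the maximal ideal have integral positive values, hence
    values at least 1. *)
Lemma poly_congr_val nu (F G : {poly k}) :
  poly_congr v nu F G -> val_congr nu F G.
Proof.
move=> h i; have [s hs ->] := h i; apply: val_ge_sum => t /hs [tO tm].
rewrite val_mul -[leLHS]add0e; apply: leeD => //.
suff mpow (l : seq k) : all (maximal_ideal v) l ->
    (((size l)%:R : rat)%:E <= v (\prod_(a <- l) a)%R)%E.
  by have := mpow t.2 tm; rewrite size_tuple.
elim: l => [|a l IH] /=; first by rewrite big_nil val_one.
move=> /andP[am /IH lm]; rewrite big_cons val_mul -nat1r EFinD leeD //.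
have {am} : (0 < v a)%E := am.
have [->|a0] := eqVneq a 0; first by rewrite val_zero leey.
by have [z ->] := val_int a0; rewrite lte_fin lee_fin ltr0z ler1z -gtz0_ge1.
Qed.

Lemma val_congr_sym nu F G : val_congr nu F G -> val_congr nu G F.
Proof. by move=> h i; rewrite -opprB coefN val_opp. Qed.

Lemma val_congr_horner nu F G x :
  val_congr nu F G -> x \in valuation_ring vbar ->
  ((nu%:R)%:E <= vbar (F^^.[x] - G^^.[x])%R)%E.
Proof.
move=> h xO; rewrite -hornerN -hornerD -rmorphB; apply: horner_val_ge => // j.
by rewrite coef_map hext.
Qed.

Lemma val_congr_deriv_horner nu F G x :
  val_congr nu F G -> x \in valuation_ring vbar ->
  ((nu%:R)%:E <= vbar (F^`()^^.[x] - G^`()^^.[x])%R)%E.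
Proof.
move=> h xO; rewrite -hornerN -hornerD -rmorphB -derivB; apply: horner_val_ge => // j.
rewrite coef_map hext coef_deriv -[_`_j.+1 *+ _]mulr_natr val_mul -[leLHS]adde0 leeD //.
have : j.+1%:R \in valuation_ring v by apply: rpred_nat.
by rewrite inE.
Qed.

Section Perturb.
Variables (F G : {poly k}) (nu : nat).
Hypotheses (Fm : F \is monic) (FO : F \is a polyOver (valuation_ring v)).
Hypotheses (Fs : separable_poly F) (Firr : irreducible_poly F).
Hypotheses (Gm : G \is monic) (GO : G \is a polyOver (valuation_ring v)).
Hypotheses (Gs : separable_poly G) (FGdeg : deg G = deg F).
Hypothesis FG : val_congr nu F G.
Hypothesis Fbelow : forall x, root F^^ x -> slopes_below F x nu.

(** For a factorization G = a b, adding the slope inequalities of a and b gives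
    v(G(x)) < nu at a root x of F, while G(x) = (G - F)(x) has value at least nu. *)
Lemma perturb_irreducible : irreducibleO v G.
Proof.
have dF := irreducible_deg_gt0 Firr.
apply: irreducibleO_of_monic; rewrite ?FGdeg // => a b am bm aO bO Gab a0 b0.
have dab : (deg a + deg b = deg F)%N by rewrite -FGdeg Gab deg_monicM.
have [x xF] := exists_root dF.
have xO := root_in_valuation_ring Fm FO xF.
have aF : (deg a < deg F)%N by rewrite -dab -[ltnLHS]addn0 ltn_add2l.
have bF : (deg b < deg F)%N by rewrite -dab -[ltnLHS]add0n ltn_add2r.
have ax0 : a^^.[x] != 0 by apply: (root_small_neq0 Firr); rewrite ?monic_neq0.
have bx0 : b^^.[x] != 0 by apply: (root_small_neq0 Firr); rewrite ?monic_neq0.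
have := Fbelow xF am aO; have := Fbelow xF bm bO.
rewrite a0 aF b0 bF => /(_ isT) hb /(_ isT) ha.
have := val_congr_horner FG xO; rewrite (rootP xF) sub0r val_opp Gab rmorphM hornerM.
rewrite ratvalE ?mulf_neq0 // lee_fin ratvalM // => hn.
have := ltrD ha hb; rewrite -mulrDr -natrD -mulnDr dab natrM mulrC.
by rewrite ltr_pM2r ?ltr0n // ltNge hn.
Qed.

(** By multiplicativity one may assume phi irreducible, with a root z. Reciprocity
    turns the slope inequality into v(F(z)) < nu, so that F(z) dominates
    G(z) - F(z) and v(G(z)) = v(F(z)); reciprocity again translates this back. *)
Lemma perturb_ratval (phi : {poly k}) x y :
  phi \is monic -> phi \is a polyOver (valuation_ring v) -> separable_poly phi ->
  (deg phi < deg F)%N -> root F^^ x -> root G^^ y ->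
  ratval vbar phi^^.[x] = ratval vbar phi^^.[y].
Proof.
move=> + + + + xF yG.
have Girr := irreducibleO_irreducible_poly Gm GO perturb_irreducible.
move: {2}(deg phi).+1 (ltnSn (deg phi)) => N.
elim: N phi => [//|N IH] phi phiN pm pO ps pF.
have [dp0|dp] := posnP (deg phi).
  by rewrite (monic_deg0 pm dp0) !rmorph1 !hornerE.
have [pirr|npirr] := pselect (irreducible_poly phi); last first.
  have [a [b [am bm pab /andP[da ap] /andP[db bp]]]] :=
    monic_reducible_split pm dp npirr.
  have adv : a %| phi by rewrite pab dvdp_mulr.
  have bdv : b %| phi by rewrite pab dvdp_mull.
  have aF := ltn_trans ap pF; have bF := ltn_trans bp pF.
  have xn p : p \is monic -> (deg p < deg F)%N -> p^^.[x] != 0.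
    by move=> pm' pF'; apply: (root_small_neq0 Firr); rewrite ?monic_neq0.
  have yn p : p \is monic -> (deg p < deg F)%N -> p^^.[y] != 0.
    by move=> pm' pF'; apply: (root_small_neq0 Girr); rewrite ?monic_neq0 ?FGdeg.
  rewrite pab !rmorphM !hornerM !ratvalM ?xn ?yn //.
  rewrite (IH a) ?(IH b) ?(dvdp_separable adv) ?(dvdp_separable bdv) //.
  - exact: leq_trans bp _.
  - exact: monic_factor_polyOver pm pO bm bdv.
  - exact: leq_trans ap _.
  - exact: monic_factor_polyOver pm pO am adv.
have [z zp] := exists_root dp.
have zO := root_in_valuation_ring pm pO zp.
have pG : (deg phi < deg G)%N by rewrite FGdeg.
have nF0 : (deg F)%:R != 0 :> rat by rewrite pnatr_eq0 -lt0n (leq_ltn_trans _ pF).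
have recF := reciprocity Fm FO Fs Firr pm pO ps pirr pF xF zp.
have recG := reciprocity Gm GO Gs Girr pm pO ps pirr pG yG zp.
apply: (mulfI nF0); rewrite -{2}FGdeg recF recG; congr (_ * _).
have := Fbelow xF pm pO; rewrite dp pF => /(_ isT).
rewrite recF mulrC natrM ltr_pM2r ?ltr0n // => Fz.
have Fz0 : F^^.[z] != 0.
  by apply: contraTneq zp => /eqP; apply: (root_small_neq0 Firr); rewrite ?monic_neq0.
rewrite /ratval; congr fine.
have -> : G^^.[z] = F^^.[z] + (G^^.[z] - F^^.[z]) by rewrite addrC subrK.
rewrite val_add_lt //; rewrite ratvalE //.
apply: lt_le_trans (val_congr_horner (val_congr_sym FG) zO).
by rewrite lte_fin.
Qed.

(** By [perturb_ratval] the slope inequality passes from F to G on separable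
    polynomials, so delta_0(G) < nu, whereas F(y) = (F - G)(y) has value at
    least nu at every root y of G. *)
Lemma perturb_equiv : (0 < nu)%N -> okutsu_equiv iota v vbar G F.
Proof.
move=> nu0; have Girr := irreducibleO_irreducible_poly Gm GO perturb_irreducible.
split=> // y yG.
have yO := root_in_valuation_ring Gm GO yG.
apply: (@lt_le_trans _ _ (nu%:R)%:E); last first.
  by have := val_congr_horner FG yO; rewrite (rootP yG) subr0.
apply: (delta0_lt Gm GO Girr nu0) => z zG phi pm pO ps; rewrite FGdeg => pd.
have [_ pF] := andP pd.
have [x xF] := exists_root (irreducible_deg_gt0 Firr).
by rewrite -(perturb_ratval pm pO ps pF xF zG); apply: Fbelow.
Qed.

End Perturb.

(** * Discriminants *)

(** Let c = v(F'(x)) < nu/2; then v(G'(x)) = c and v(G(x)) >= nu. The logarithmic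
    derivative G'(x)/G(x) is the sum of the 1/(x - y) over the roots y of G, so
    some y satisfies v(x - y) >= v(G(x)) - c >= nu - c > c, and G'(y) is then so
    close to G'(x) that it has the same value. *)
Lemma close_root_deriv (F G : {poly k}) (nu : nat) x :
  F \is monic -> F \is a polyOver (valuation_ring v) -> separable_poly F ->
  G \is monic -> G \is a polyOver (valuation_ring v) -> separable_poly G ->
  val_congr nu F G -> root F^^ x ->
  2 * ratval vbar F^`()^^.[x] < nu%:R ->
  exists2 y, root G^^ y & ratval vbar G^`()^^.[y] = ratval vbar F^`()^^.[x].
Proof.
move=> Fm FO Fs Gm GO Gs FG xF dnu.
have xO := root_in_valuation_ring Fm FO xF.
set c := ratval vbar F^`()^^.[x] in dnu *.
have F'x : vbar F^`()^^.[x] = c%:E by rewrite ratvalE ?root_deriv_neq0.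
have F'O : F^`() \is a polyOver (valuation_ring v) by apply: polyOver_deriv.
have G'O : G^`() \is a polyOver (valuation_ring v) by apply: polyOver_deriv.
have c0 : 0 <= c.
  by rewrite -lee_fin -F'x; apply: (horner_in_valuation_ring F'O xO).
have G'x : vbar G^`()^^.[x] = c%:E.
  have -> : G^`()^^.[x] = F^`()^^.[x] + (G^`()^^.[x] - F^`()^^.[x]).
    by rewrite addrC subrK.
  rewrite val_add_lt F'x //.
  apply: lt_le_trans (val_congr_deriv_horner (val_congr_sym FG) xO).
  by rewrite lte_fin; lra.
suff [y yG xy] : exists2 y, root G^^ y & (c%:E < vbar (y - x)%R)%E.
  exists y => //; have yO := root_in_valuation_ring Gm GO yG.
  suff : vbar G^`()^^.[y] = c%:E by rewrite /ratval => ->.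
  have -> : G^`()^^.[y] = G^`()^^.[x] + (G^`()^^.[y] - G^`()^^.[x]).
    by rewrite addrC subrK.
  rewrite val_add_lt G'x //; apply: lt_le_trans xy (val_horner_sub _ yO xO).
  by rewrite polyOver_map.
have Gx : ((nu%:R)%:E <= vbar G^^.[x])%E.
  by have := val_congr_horner FG xO; rewrite (rootP xF) sub0r val_opp.
have [rs [rsu Grs szrs rsP]] := separable_split Gm Gs.
have [/hasP[y]|/hasPn far] := boolP (has (fun y => c%:E < vbar (y - x)%R)%E rs).
  by rewrite rsP; exists y.
have : (c%:E < vbar G^`()^^.[x])%E; last by rewrite G'x ltxx.
rewrite -deriv_map Grs deriv_prod_XsubC // horner_sum; apply: val_gt_sum => y yrs.
have := far y yrs; rewrite -leNgt => xyc.
have xy0 : x - y != 0.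
  apply: contraTneq xyc => /subr0_eq ->; by rewrite subrr val_zero -ltNge ltry.
have xyc' : ratval vbar (x - y) <= c.
  by move: xyc; rewrite -opprB val_opp ratvalE.
have GE : G^^.[x] = (x - y) * (cofactor_at rs y).[x].
  by rewrite Grs (bigD1_seq y) //= hornerM hornerXsubC.
have [->|cx0] := eqVneq (cofactor_at rs y).[x] 0; first by rewrite val_zero ltry.
rewrite ratvalE // lte_fin.
move: Gx; rewrite GE ratvalE ?mulf_neq0 // lee_fin ratvalM //; lra.
Qed.

Lemma val_discriminant (F : {poly k}) (rs : seq kbar) :
  F \is monic -> separable_poly F -> uniq rs -> F^^ = \prod_(x <- rs) ('X - x%:P) ->
  (0 < deg F)%N ->
  v (discriminant F) = (\sum_(x <- rs) ratval vbar F^`()^^.[x])%:E.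
Proof.
move=> Fm Fs rsu Frs dF.
have d0 x : x \in rs -> F^`()^^.[x] != 0.
  by move=> xrs; apply: root_deriv_neq0 => //; rewrite Frs root_prod_XsubC.
have F'0 : F^`() != 0.
  have [x xF] := exists_root dF.
  apply: contraTneq (root_deriv_neq0 Fm Fs xF) => ->; by rewrite rmorph0 horner0 eqxx.
have vsign m : v ((-1) ^+ m) = 0%E.
  by elim: m => [|m IH]; rewrite ?expr0 ?val_one // exprS mulN1r val_opp.
have -> : v (discriminant F) = vbar (resultant F^`()^^ F^^).
  by rewrite resultant_map hext /discriminant val_mul vsign add0e.
rewrite Frs resultant_prod_roots ?map_poly_eq0 // ratvalE ?ratval_prod //.
by rewrite prodf_seq_neq0; apply/allP => x xrs; rewrite d0.
Qed.

(** The value of the discriminant is the sum of the n values v(F'(x)), so one of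
    them is less than nu/2. *)
Lemma slopes_below_of_discriminant (F G : {poly k}) (n nu : nat) :
  F \is monic -> F \is a polyOver (valuation_ring v) -> separable_poly F ->
  G \is monic -> G \is a polyOver (valuation_ring v) -> separable_poly G ->
  irreducible_poly G -> deg F = n -> deg G = n -> val_congr nu F G ->
  ((2%:R)%:E * v (discriminant F) / (n%:R)%:E < (nu%:R)%:E)%E ->
  forall y, root G^^ y -> slopes_below G y nu.
Proof.
move=> Fm FO Fs Gm GO Gs Girr Fn Gn FG.
have n0 : (0 < n)%N.
  by rewrite -Gn; apply: irreducible_deg_gt0.
have [rs [rsu Frs szrs rsP]] := separable_split Fm Fs.
rewrite (val_discriminant Fm Fs rsu Frs) ?Fn // inve_natr // -!EFinM lte_fin.
rewrite ltr_pdivrMr ?ltr0n // => disc y yG.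
have [/hasP[x xrs dx]|/hasPn big] :=
  boolP (has (fun x => 2 * ratval vbar F^`()^^.[x] < nu%:R) rs).
  have xF : root F^^ x by rewrite -rsP.
  have [z zG dz] := close_root_deriv Fm FO Fs Gm GO Gs FG xF dx.
  apply: (slopes_below_of_deriv ) => //.
  by rewrite (ratval_conj Gm GO Gs Girr _ yG zG) dz.
move: disc; rewrite ltNge mulr_sumr => /negP[].
rewrite mulr_natr -Fn -szrs -(count_predT rs) -iter_addr_0 -big_const_seq.
by rewrite !big_seq; apply: ler_sum => x /big; rewrite -leNgt.
Qed.

End Extension.

Theorem theorem2p3
  (k : fieldType) (v : valuation k)
  (hdisc : normalized_discrete v)
  (hcomplete : val_complete v)
  (hlc : val_locally_compact v)
  (kbar : closedFieldType) (iota : {rmorphism k -> kbar})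
  (halg : forall z : kbar, algebraicOver iota z)
  (vbar : valuation kbar)
  (hext : forall x : k, vbar (iota x) = v x)
  (n nu : nat) (hnu : (0 < nu)%N)
  (F G : {poly k})
  (hFO : F \is a polyOver (valuation_ring v))
  (hGO : G \is a polyOver (valuation_ring v))
  (hFm : F \is monic) (hGm : G \is monic)
  (hFs : separable_poly F) (hGs : separable_poly G)
  (hFn : deg F = n) (hGn : deg G = n)
  (hFG : poly_congr v nu F G) :
  (irreducibleO v F ->
   (okutsu_delta0 iota v vbar F < (nu%:R)%:E)%E ->
   irreducibleO v G /\ okutsu_equiv iota v vbar G F)
  /\
  (irreducibleO v G ->
   ((2%:R)%:E * v (discriminant F) / (n%:R)%:E < (nu%:R)%:E)%E ->
   irreducibleO v F /\ okutsu_equiv iota v vbar F G).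
Proof.
have FG := poly_congr_val hdisc hFG; have GF := val_congr_sym FG.
have perturb := perturb_irreducible hext.
have equiv := perturb_equiv hdisc hcomplete hext.
split=> [Firr dF|Girr dF].
  have {}Firr := irreducibleO_irreducible_poly hext hFm hFO Firr.
  have below := slopes_below_of_delta0 hdisc hcomplete hext hFm hFO hFs Firr dF.
  split; first by apply: (perturb F G nu) => //; rewrite hGn.
  by apply: (equiv F G nu) => //; rewrite hGn.
have {}Girr := irreducibleO_irreducible_poly hext hGm hGO Girr.
have below := slopes_below_of_discriminant hdisc hcomplete hext
  hFm hFO hFs hGm hGO hGs Girr hFn hGn FG dF.
split; first by apply: (perturb G F nu) => //; rewrite hGn.
by apply: (equiv G F nu) => //; rewrite hGn.
Qed.
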